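(* Let $\mathrm{J}:\mathbb{N}\to[0,\infty)$ be a summable sequence with $\mathrm{J}(0)=0$, let $r_n=\sum_{k=n+1}^\infty \mathrm{J}(k)$ for $n\ge 0$, and let $\phi(x)=x_0\sum_{k=1}^\infty \mathrm{J}(k)x_k$ for $x\in X=\{-1,+1\}^{\mathbb{N}}$. Let $\mathscr{L}=\mathscr{L}_\phi$ be the associated transfer operator on $C(X)$ and $\lambda=\lambda_\phi$ its spectral radius. For $x\in X$ define $r(x)=\sum_{n=0}^\infty r_n x_n$. If $\nu\in\mathscr{M}_\phi$ (the set of eigenmeasures of $\mathscr{L}_\phi$) and $$\int e^{r(x)}\,d\nu(x)<\infty,$$ then there is a strictly positive continuous function $h\in C(X)$ such that $\mathscr{L}h=\lambda h$.
   Context: $\mathbb{N}=\{0,1,2,\dots\}$. The space $X=\{-1,+1\}^{\mathbb{N}}$ has the product topology and Borel sigma-algebra; $C(X)$ is the space of continuous real functions on $X$. $T:X\to X$ is the left shift $(Tx)_i=x_{i+1}$. For $\phi\in C(X)$ the transfer operator is $\mathscr{L}_\phi f(x)=\sum_{y\in T^{-1}x}e^{\phi(y)}f(y)$, $f\in C(X)$. $\mathscr{M}_\phi$ is the set of Borel probability measures $\nu$ on $X$ for which there is $\lambda>0$ with $\int \mathscr{L}_\phi f\,d\nu=\lambda\int f\,d\nu$ for all $f\in C(X)$; the eigenvalue $\lambda=\lambda_\phi$ is unique and equals the spectral radius of $\mathscr{L}_\phi$. The hypothesis on $\int e^{r}\,d\nu$ is understood to include that the series defining $r(x)$ converges for $\nu$-almost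 every $x$. *)

(* Defs.v *)
From HB Require Import structures.
From mathcomp Require Import all_boot all_order all_algebra.
From mathcomp Require Import all_classical all_reals all_analysis.

Set Implicit Arguments.
Unset Strict Implicit.
Unset Printing Implicit Defensive.

Import Order.TTheory GRing.Theory Num.Theory.
Import numFieldNormedType.Exports.

Local Open Scope classical_set_scope.
Local Open Scope ring_scope.

(* X = {-1,+1}^nat is represented by [cantor_space] = bool^nat (product
   topology); a coordinate is turned into a real number by [spin]. *)
Definition spin (R : realType) (b : bool) : R := if b then 1 else -1.

Definition borel_cantor := g_sigma_algebraType (@open cantor_space).

Definition left_shift (x : cantor_space) : cantor_space := fun i => x i.+1.

Definition CX (R : realType) : set (cantor_space -> R) :=
  [set f | continuous f].

(* The preimage of a point has two elements, so the finitely supported sum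
   below is the full sum. *)
Definition transfer (R : realType) (phi f : cantor_space -> R) :
    cantor_space -> R :=
  fun x => \sum_(y \in left_shift @^-1` [set x]) (expR (phi y) * f y).

Definition eigenmeasures (R : realType) (phi : cantor_space -> R) :
    set (probability borel_cantor R) :=
  [set nu : probability borel_cantor R | exists2 lambda : R, 0 < lambda &
     forall f : cantor_space -> R, CX f ->
       \int[nu]_x transfer phi f x = lambda * \int[nu]_x f x].

(* The spectrum of an operator A on the real Banach space C(X) is that of its
   complexification f + ig |-> Af + i Ag on C(X, C). Both the complex number
   z = a + ib and the function f + ig are encoded as pairs, and
   [complex_shift A z] is z - A. By the open mapping theorem a bounded operator
   has a bounded inverse as soon as it is bijective. *)
Definition complex_shift (R : realType)
    (A : (cantor_space -> R) -> (cantor_space -> R)) (z : R * R)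
    (F : (cantor_space -> R) * (cantor_space -> R)) :
    (cantor_space -> R) * (cantor_space -> R) :=
  (fun x => z.1 * F.1 x - z.2 * F.2 x - A F.1 x,
   fun x => z.1 * F.2 x + z.2 * F.1 x - A F.2 x).

Definition spectrum (R : realType)
    (A : (cantor_space -> R) -> (cantor_space -> R)) : set (R * R) :=
  [set z | ~ set_bij (@CX R `*` @CX R) (@CX R `*` @CX R) (complex_shift A z)].

Definition spectral_radius (R : realType)
    (A : (cantor_space -> R) -> (cantor_space -> R)) : R :=
  sup [set Num.sqrt (z.1 ^+ 2 + z.2 ^+ 2) | z in spectrum A].

Definition potential (R : realType) (J : nat -> R) : cantor_space -> R :=
  fun x => spin R (x 0%N) * \big[+%R/0]_(1 <= k <oo) (J k * spin R (x k)).

Definition tail_sum (R : realType) (J : nat -> R) (n : nat) : R :=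
  \big[+%R/0]_(n.+1 <= k <oo) J k.

Definition r_term (R : realType) (J : nat -> R) (x : cantor_space) :
    nat -> R :=
  fun n => tail_sum J n * spin R (x n).

(* Meaningful where the series converges; elsewhere the value is a default. *)
Definition r_fun (R : realType) (J : nat -> R) (x : cantor_space) : R :=
  \big[+%R/0]_(0 <= n <oo) r_term J x n.

(* Main.v *)
(* Iterating the transfer operator N times on a function of the first N spins
   gives a partition function of the ferromagnetic Ising model on a block of N
   sites, with fields created by the spins to the right of the block. Let Q_N be
   the mean of exp(r) under the state of this block with free boundary, where r
   is computed from the right end of the block. By Griffiths' inequality the
   normalized iterates of 1 form a uniform Cauchy sequence as soon as the
   increasing sequence Q_N is bounded, and the limit is the eigenfunction.

   Q_N is bounded trivially if the sum of the r_n is finite. Otherwise consider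
   the mean m_i of the spin i in a block with plus spins on its right, as the
   length of the block tends to infinity.
   - If some m_i is positive, comparison of the boundary conditions plus-plus and
     plus-minus and the FKG inequality give d > 0 such that the integral of
     e^r (x_i - d) with respect to nu is nonnegative for every i. Averaging over i
     with weights r_i contradicts the almost sure convergence of r, as the total
     weight is infinite.
   - If all m_i vanish, then nu is the limit of the free states, and FKG together
     with spin flip symmetry bounds Q_N by the integral of e^r. *)
Require Import Defs.
From HB Require Import structures.
From mathcomp Require Import all_boot all_order all_algebra.
From mathcomp Require Import all_classical all_reals all_analysis.
From mathcomp Require Import measurable_realfun ring lra zify.

Set Implicit Arguments.
Unset Strict Implicit.
Unset Printing Implicit Defensive.

Import Order.TTheory GRing.Theory Num.Theory.
Import numFieldNormedType.Exports.

Local Open Scope classical_set_scope.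
Local Open Scope ring_scope.

(** * Sums over finite words *)

(** The number r_i is the field that a plus half-line exerts on the site separated from it by i
    sites. Weighting nu by e^r thus amounts to putting plus spins on the whole left half-line. This
    is why the second case compares plus-plus with plus-minus: under the weighted measure the left
    side is plus, and the worst right side is minus. A minus side might a priori be felt at every
    spin. However, the plus-minus partition function never exceeds the plus-plus one, so there are
    arbitrarily long blocks for which one more site does not favour the minus side by more than a
    given margin. This forces the two means of suitable spins near the left end to be close.

    The function e^r is in general neither bounded nor continuous, while the eigenmeasure equation
    concerns continuous functions only. Inequalities are therefore proved for minima of two
    exponentials of finite sums and carried over by dominated convergence.

    The eigenvalue first appears as a limit of ratios of free partition functions; positivity of the
    eigenfunction then identifies it with the spectral radius. *)

Definition scons (a : bool) (x : nat -> bool) : nat -> bool :=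
  fun i => if i is j.+1 then x j else a.

Definition all_plus : nat -> bool := fun=> true.

Definition spin_flip (x : nat -> bool) : nat -> bool := fun i => ~~ x i.

Definition spin_mul (x y : nat -> bool) : nat -> bool := fun i => x i == y i.

(** Full configurations with a fixed tail [y], rather than tuples, let one notion serve both for
    Gibbs sums on a block, where the tail is irrelevant, and for iterates of the transfer operator,
    where it is the point of evaluation. *)
Fixpoint psum (R : realType) (N : nat) (y : nat -> bool)
    (F : (nat -> bool) -> R) : R :=
  if N is n.+1 then psum n y (F \o scons true) + psum n y (F \o scons false)
  else F y.

Section PrefixSums.
Context {R : realType}.
Implicit Types (F G : (nat -> bool) -> R) (x y : nat -> bool) (N : nat).

Lemma scons_shift x : scons (x 0%N) (fun i => x i.+1) = x.
Proof. by apply/funext => -[]. Qed.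

Lemma spinN b : spin R (~~ b) = - spin R b.
Proof. by case: b; rewrite /spin /= ?opprK. Qed.

Lemma spin_norm b : `|spin R b| = 1.
Proof. by case: b; rewrite /spin ?normrN normr1. Qed.

Lemma spin_sqr b : spin R b * spin R b = 1.
Proof. by case: b; rewrite /spin; ring. Qed.

Lemma spin_eqb a b : spin R (a == b) = spin R a * spin R b.
Proof. by case: a; case: b; rewrite /spin /=; ring. Qed.

Lemma eq_psum_in N y F G :
  (forall x, (forall i, x (N + i)%N = y i) -> F x = G x) ->
  psum N y F = psum N y G.
Proof.
elim: N F G => [|N IH] F G FG /=; first by apply: FG.
by congr (_ + _); apply: IH => x xy; apply: FG => i; rewrite addSn /= xy.
Qed.

Lemma eq_psum N y F G : F =1 G -> psum N y F = psum N y G.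
Proof. by move=> FG; apply: eq_psum_in. Qed.

Lemma psumD N y F G : psum N y (fun x => F x + G x) = psum N y F + psum N y G.
Proof.
elim: N F G => [//|N IH] F G /=.
rewrite (IH (F \o _) (G \o _)) (IH (F \o scons false) (G \o _)); ring.
Qed.

Lemma psumZ N y c F : psum N y (fun x => c * F x) = c * psum N y F.
Proof.
elim: N F => [//|N IH] F /=.
rewrite (IH (F \o _)) (IH (F \o scons false)); ring.
Qed.

Lemma psumB N y F G : psum N y (fun x => F x - G x) = psum N y F - psum N y G.
Proof.
rewrite -mulN1r -psumZ -psumD.
by apply: eq_psum => x; rewrite mulN1r.
Qed.

Lemma psum_ge0 N y F : (forall x, 0 <= F x) -> 0 <= psum N y F.
Proof. by elim: N F => [|N IH] F F0 /=; [exact: F0|apply: addr_ge0; apply: IH => x; exact: F0]. Qed.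

Lemma psum_gt0 N y F : (forall x, 0 < F x) -> 0 < psum N y F.
Proof. by elim: N F => [|N IH] F F0 /=; [exact: F0|apply: addr_gt0; apply: IH => x; exact: F0]. Qed.

Lemma ler_psum N y F G : (forall x, F x <= G x) -> psum N y F <= psum N y G.
Proof.
move=> FG; rewrite -subr_ge0 -psumB; apply: psum_ge0 => x.
by rewrite subr_ge0.
Qed.

Lemma psum_last N y F :
  psum N.+1 y F = psum N (scons true y) F + psum N (scons false y) F.
Proof.
elim: N F => [//|N IH] F.
rewrite -[LHS]/(psum N.+1 y (F \o scons true) + psum N.+1 y (F \o scons false)).
by rewrite !IH /=; ring.
Qed.

Lemma psum_exchange N M y z (F : (nat -> bool) -> (nat -> bool) -> R) :
  psum N y (fun u => psum M z (F u)) = psum M z (fun v => psum N y (F^~ v)).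
Proof.
elim: N F => [//|N IH] F /=; rewrite psumD.
by congr (_ + _); apply: (IH (fun u => F (scons _ u))).
Qed.

Definition prefix_fun N F :=
  forall x x', (forall i, (i < N)%N -> x i = x' i) -> F x = F x'.

Lemma prefix_fun_scons N F a : prefix_fun N.+1 F -> prefix_fun N (F \o scons a).
Proof. by move=> dF x x' xx'; apply: dF => -[|i]//= /xx'. Qed.

Lemma prefix_funW N M F : (N <= M)%N -> prefix_fun N F -> prefix_fun M F.
Proof. by move=> NM dF x x' xx'; apply: dF => i iN; apply/xx'/leq_trans/NM. Qed.

Lemma psum_base N y y' F : prefix_fun N F -> psum N y F = psum N y' F.
Proof.
elim: N F => [|N IH] F dF /=; first exact: dF.
by congr (_ + _); apply/IH/prefix_fun_scons.
Qed.

Lemma psum_flip N y F : psum N y (F \o spin_flip) = psum N (spin_flip y) F.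
Proof.
elim: N F => [//|N IH] F /=; rewrite addrC; congr (_ + _); rewrite -IH;
  by apply: eq_psum => x /=; congr F; apply/funext => -[].
Qed.

(** Multiplication by [x] permutes the words of length [N] and turns the plus tail into the tail of
    [x]. *)
Lemma psum_mul N x F :
  psum N all_plus (F \o spin_mul x) = psum N (fun i => x (N + i)%N) F.
Proof.
elim: N x F => [|N IH] x F /=.
  by congr F; apply/funext => i; rewrite /spin_mul /all_plus; case: (x i).
have E a : psum N all_plus (F \o spin_mul x \o scons a) =
    psum N (fun i => x (N.+1 + i)%N) (F \o scons (x 0%N == a)).
  rewrite -(IH (fun i => x i.+1)); apply: eq_psum => z /=; congr F.
  by apply/funext => -[].
by rewrite !E; case: (x 0%N) => //=; rewrite addrC.
Qed.

Definition rev_prefix N x : nat -> bool :=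
  fun i => if (i < N)%N then x (N - i.+1)%N else x i.

Lemma psum_rev N y F : prefix_fun N F ->
  psum N y (F \o rev_prefix N) = psum N y F.
Proof.
elim: N y F => [|N IH] y F dF.
  by rewrite /=; congr F; apply/funext.
have rev_dep a : prefix_fun N (F \o scons a \o rev_prefix N).
  move=> x x' xx'; apply: dF => -[|i]//=; rewrite ltnS => iN.
  by rewrite /rev_prefix iN xx' // subnSK // leq_subr.
have E a : psum N (scons a y) (F \o rev_prefix N.+1) =
    psum N y (F \o scons a \o rev_prefix N).
  rewrite -(psum_base (scons a y) _ (rev_dep a)); apply: eq_psum_in => x xa.
  apply: dF => -[_|i]; rewrite /rev_prefix.
    by have := xa 0%N; rewrite addn0 subSS subn0.
  by rewrite !ltnS subSS => /[dup] iN -> /=; rewrite iN.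
rewrite psum_last !E /=; congr (_ + _); apply: IH; exact: prefix_fun_scons.
Qed.

End PrefixSums.

(** * Griffiths' inequalities *)

Section Griffiths.
Context {R : realType}.
Implicit Types (F G P : (nat -> bool) -> R) (x y : nat -> bool) (N : nat).

(* The functions whose expansions into characters [char] have nonnegative
   coefficients. *)
Inductive pos_char : ((nat -> bool) -> R) -> Prop :=
| pos_cst c : 0 <= c -> pos_char (fun=> c)
| pos_spin i : pos_char (fun x => spin R (x i))
| pos_add F G : pos_char F -> pos_char G -> pos_char (fun x => F x + G x)
| pos_mul F G : pos_char F -> pos_char G -> pos_char (fun x => F x * G x).

Lemma eq_pos F G : F =1 G -> pos_char F -> pos_char G.
Proof. by move=> /funext ->. Qed.

Lemma posZ c F : 0 <= c -> pos_char F -> pos_char (fun x => c * F x).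
Proof. by move=> c0; apply: pos_mul; exact: pos_cst. Qed.

Lemma pos_comp_shift F : pos_char F -> pos_char (fun x => F (fun i => x i.+1)).
Proof.
elim=> [c c0|i|F' G' _ ? _ ?|F' G' _ ? _ ?].
- exact: pos_cst.
- exact: (pos_spin i.+1).
- exact: pos_add.
- exact: pos_mul.
Qed.

(* The cone is stable under averaging and differencing over a sign change, since
   [FG +/- F'G'] is half of [(F+F')(G+/-G') + (F-F')(G-/+G')]. *)
Lemma pos_pair (A B : ((nat -> bool) -> nat -> bool)) :
  (forall i, pos_char (fun x => spin R (A x i) + spin R (B x i)) /\
             pos_char (fun x => spin R (A x i) - spin R (B x i))) ->
  forall F, pos_char F -> pos_char (fun x => F (A x) + F (B x)) /\
                          pos_char (fun x => F (A x) - F (B x)).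
Proof.
move=> AB F; elim=> [c c0|i|{}F G _ [Fp Fm] _ [Gp Gm]|{}F G _ [Fp Fm] _ [Gp Gm]].
- split; first by apply: pos_cst; exact: addr_ge0.
  by apply: (@eq_pos (fun=> 0)) (pos_cst _) => // x; rewrite subrr.
- exact: AB.
- split; [apply: eq_pos (pos_add Fp Gp)|apply: eq_pos (pos_add Fm Gm)] => x /=;
    ring.
- have h0 : 0 <= 2^-1 :> R by rewrite invr_ge0.
  split.
    apply: eq_pos (posZ h0 (pos_add (pos_mul Fp Gp) (pos_mul Fm Gm))) => x /=.
    by field.
  apply: eq_pos (posZ h0 (pos_add (pos_mul Fp Gm) (pos_mul Fm Gp))) => x /=.
  by field.
Qed.

Lemma pos_scons F : pos_char F ->
  pos_char (fun x => F (scons true x) + F (scons false x)) /\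
  pos_char (fun x => F (scons true x) - F (scons false x)).
Proof.
apply: pos_pair => -[|i] /=; split.
- by apply: eq_pos (pos_cst (lexx 0)) => x; rewrite /spin /= subrr.
- by apply: (@eq_pos (fun=> 2)) => [x|]; [rewrite /spin; ring|exact: pos_cst].
- by apply: eq_pos (pos_add (pos_spin i) (pos_spin i)).
- by apply: eq_pos (pos_cst (lexx 0)) => x; rewrite subrr.
Qed.

Lemma pos_spin_mul y F : pos_char F ->
  pos_char (fun x => F x + F (spin_mul x y)) /\
  pos_char (fun x => F x - F (spin_mul x y)).
Proof.
apply: (@pos_pair id (fun x => spin_mul x y)) => i; split.
- apply: (@eq_pos (fun x => (1 + spin R (y i)) * spin R (x i))) => [x|].
    by rewrite /spin_mul spin_eqb; ring.
  by apply: posZ (pos_spin i); rewrite /spin; case: (y i); lra.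
- apply: (@eq_pos (fun x => (1 - spin R (y i)) * spin R (x i))) => [x|].
    by rewrite /spin_mul spin_eqb; ring.
  by apply: posZ (pos_spin i); rewrite /spin; case: (y i); lra.
Qed.

(** Summing out a spin preserves the cone, and at the all-plus configuration its members are
    nonnegative. Combined with [pos_expR] this is Griffiths' first inequality. *)
Lemma psum_pos N F : pos_char F -> 0 <= psum N all_plus F.
Proof.
elim: N F => [|N IH] F posF /=.
  elim: posF => [//|i|? ? _ ? _ ?|? ? _ ? _ ?] /=; first by rewrite /spin.
    exact: addr_ge0.
  exact: mulr_ge0.
by rewrite -psumD; apply: IH; have [] := pos_scons posF.
Qed.

Definition char (s : seq nat) x : R := \prod_(i <- s) spin R (x i).

Lemma pos_char_prod s : pos_char (char s).
Proof.
elim: s => [|i s IH].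
  by apply: eq_pos (pos_cst ler01) => x; rewrite /char big_nil.
by apply: eq_pos (pos_mul (pos_spin i) IH) => x; rewrite /char big_cons.
Qed.

Lemma charM s x y : char s (spin_mul x y) = char s x * char s y.
Proof. by rewrite /char -big_split; apply: eq_bigr => i _; exact: spin_eqb. Qed.

Lemma char_sqr s x : char s x * char s x = 1.
Proof. by rewrite /char -big_split; apply: big1 => i _; exact: spin_sqr. Qed.

Lemma char_pm1 s x : char s x = 1 \/ char s x = -1.
Proof.
have /eqP := char_sqr s x; rewrite -expr2 sqrf_eq1.
by move=> /orP[] /eqP ->; [left|right].
Qed.

Definition coshR (c : R) := (expR c + expR (- c)) / 2.
Definition sinhR (c : R) := (expR c - expR (- c)) / 2.

Lemma expR_char c s x : expR (c * char s x) = coshR c + sinhR c * char s x.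
Proof.
rewrite /coshR /sinhR.
by case: (char_pm1 s x) => ->; rewrite ?mulrN ?mulr1; field.
Qed.

Lemma coshR_ge1 c : 1 <= coshR c.
Proof.
rewrite /coshR expRN ler_pdivlMr // mul1r.
have e0 := expR_gt0 c; rewrite -subr_ge0.
have -> : expR c + (expR c)^-1 - 2 = (expR c - 1) ^+ 2 / expR c.
  by field; rewrite gt_eqF.
by rewrite divr_ge0 ?sqr_ge0 // ltW.
Qed.

Lemma sinhR_le c d : c <= d -> sinhR c <= sinhR d.
Proof.
move=> cd; rewrite /sinhR ler_pM2r ?invr_gt0 //.
by apply: lerB; rewrite ler_expR ?lerN2.
Qed.

Lemma sinhR0 : sinhR 0 = 0. Proof. by rewrite /sinhR oppr0 subrr mul0r. Qed.

Lemma sinhRN c : sinhR (- c) = - sinhR c.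
Proof. by rewrite /sinhR opprK; field. Qed.

Lemma coshRN c : coshR (- c) = coshR c.
Proof. by rewrite /coshR opprK addrC. Qed.

Lemma coshR_le c d : `|c| <= d -> coshR c <= coshR d.
Proof.
move=> cd; have [c' [-> c'0 c'd]] : exists c', [/\ coshR c = coshR c', 0 <= c' & c' <= d].
  exists `|c|; split => //; have [c0|c0] := ger0P c => //.
  by rewrite coshRN.
have e1 : 1 <= expR c' by rewrite -expR0 ler_expR.
have e2 : expR c' <= expR d by rewrite ler_expR.
rewrite /coshR ler_pM2r ?invr_gt0 // !expRN.
have c0 : 0 < expR c' by exact: expR_gt0.
have d0 : 0 < expR d by exact: expR_gt0.
rewrite -subr_ge0.
have -> : expR d + (expR d)^-1 - (expR c' + (expR c')^-1) =
  (expR d - expR c') * (expR d * expR c' - 1) / (expR d * expR c').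
  by field; rewrite !gt_eqF.
apply: divr_ge0; last by rewrite mulr_ge0 // ltW.
apply: mulr_ge0; first by rewrite subr_ge0.
by rewrite subr_ge0 (le_trans e1) // ler_peMl ?(ltW c0) // (le_trans e1).
Qed.

(** Energies of ferromagnetic many-body interactions. Products are not constructors here, so that
    the exponential becomes a product of exponentials of single characters. *)
Inductive ferro : ((nat -> bool) -> R) -> Prop :=
| ferro_char c s : 0 <= c -> ferro (fun x => c * char s x)
| ferro_add P Q : ferro P -> ferro Q -> ferro (fun x => P x + Q x).

Lemma eq_ferro P Q : P =1 Q -> ferro P -> ferro Q.
Proof. by move=> /funext ->. Qed.

Lemma ferro0 : ferro (fun=> 0).
Proof. by apply: eq_ferro (ferro_char [::] (lexx 0)) => x; rewrite mul0r. Qed.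

Lemma ferro_sum N (f : nat -> (nat -> bool) -> R) :
  (forall i, (i < N)%N -> ferro (f i)) -> ferro (fun x => \sum_(i < N) f i x).
Proof.
elim: N => [|N IH] fN.
  by apply: eq_ferro ferro0 => x; rewrite big_ord0.
have FN := IH (fun i iN => fN i (ltnW iN)).
apply: eq_ferro (ferro_add FN (fN N (ltnSn N))) => x.
by rewrite big_ord_recr.
Qed.

Lemma ferro_spin c i : 0 <= c -> ferro (fun x => c * spin R (x i)).
Proof.
move=> c0; apply: eq_ferro (ferro_char [:: i] c0) => x.
by rewrite /char big_seq1.
Qed.

Lemma ferro_spin2 c i j : 0 <= c ->
  ferro (fun x => c * (spin R (x i) * spin R (x j))).
Proof.
move=> c0; apply: eq_ferro (ferro_char [:: i; j] c0) => x.
by rewrite /char big_cons big_seq1.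
Qed.

Lemma ferro_comp_shift P : ferro P -> ferro (fun x => P (fun i => x i.+1)).
Proof.
elim=> [c s c0|? ? _ ? _ ?]; last exact: ferro_add.
apply: eq_ferro (ferro_char (map S s) c0) => x.
by rewrite /char big_map.
Qed.

Lemma pos_expR P : ferro P -> pos_char (fun x => expR (P x)).
Proof.
elim=> [c s c0|{}P Q _ posP _ posQ]; last first.
  by apply: eq_pos (pos_mul posP posQ) => x; rewrite expRD.
apply: (@eq_pos (fun x => coshR c + sinhR c * char s x)) => [x|].
  by rewrite expR_char.
apply: pos_add; first by apply/pos_cst/(le_trans ler01)/coshR_ge1.
by apply: posZ (pos_char_prod s); rewrite -sinhR0 sinhR_le.
Qed.

Lemma ferro_dup y P : ferro P -> ferro (fun x => P x + P (spin_mul x y)).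
Proof.
elim=> [c s c0|{}P Q _ HP _ HQ]; last first.
  by apply: eq_ferro (ferro_add HP HQ) => x; ring.
have c1 : 0 <= c * (1 + char s y).
  by rewrite mulr_ge0 //; case: (char_pm1 s y) => ->; lra.
by apply: eq_ferro (ferro_char s c1) => x; rewrite charM; ring.
Qed.

(* Griffiths' second inequality. Multiplying the second of two independent copies
   by the first one makes the covariance a sum over the second copy of integrals
   of functions in the cone. *)
Lemma griffiths2 N P F G : ferro P -> pos_char F -> pos_char G ->
  psum N all_plus (fun x => expR (P x) * F x) *
  psum N all_plus (fun x => expR (P x) * G x) <=
  psum N all_plus (fun x => expR (P x)) *
  psum N all_plus (fun x => expR (P x) * (F x * G x)).
Proof.
move=> fP pF pG; rewrite -subr_ge0.
pose H x z := expR (P x) * expR (P z) * (F x * (G x - G z)).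
suff -> : psum N all_plus (fun x => expR (P x)) *
    psum N all_plus (fun x => expR (P x) * (F x * G x)) -
    psum N all_plus (fun x => expR (P x) * F x) *
    psum N all_plus (fun x => expR (P x) * G x) =
    psum N all_plus (fun x => psum N all_plus (fun y => H x (spin_mul x y))).
  rewrite psum_exchange; apply: psum_ge0 => y; apply: psum_pos.
  apply: pos_mul.
    apply: eq_pos (pos_expR (ferro_dup y fP)) => x; exact: expRD.
  by apply: pos_mul => //; have [] := pos_spin_mul y pG.
transitivity (psum N all_plus (fun x => psum N all_plus (H x))); last first.
  apply: eq_psum_in => x xN; rewrite [RHS](psum_mul N x (H x)).
  by congr (psum _ _ _); apply/funext => i; rewrite xN.
transitivity (psum N all_plus (fun x =>
  expR (P x) * F x * G x * psum N all_plus (fun z => expR (P z)) -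
  expR (P x) * F x * psum N all_plus (fun z => expR (P z) * G z))); last first.
  apply: eq_psum => x; rewrite -!psumZ -psumB; apply: eq_psum => z.
  by rewrite /H; ring.
rewrite psumB; congr (_ - _).
  rewrite -psumZ; apply: eq_psum => x; ring.
rewrite mulrC -psumZ; apply: eq_psum => x; ring.
Qed.

(* The character coefficients of [F] are bounded in absolute value by those of
   [G]. *)
Definition maj G F :=
  pos_char (fun x => G x + F x) /\ pos_char (fun x => G x - F x).

(** Twice [G * G' + F * F'] is (G+F)(G'+F') + (G-F)(G'-F'), and twice the difference is (G+F)(G'-F')
    + (G-F)(G'+F'). *)
Lemma majM G F G' F' : maj G F -> maj G' F' ->
  maj (fun x => G x * G' x) (fun x => F x * F' x).
Proof.
move=> [Gp Gm] [Gp' Gm']; have h0 : 0 <= 2^-1 :> R by rewrite invr_ge0.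
split.
  by apply: eq_pos (posZ h0 (pos_add (pos_mul Gp Gp') (pos_mul Gm Gm'))) => x;
    field.
by apply: eq_pos (posZ h0 (pos_add (pos_mul Gp Gm') (pos_mul Gm Gp'))) => x;
  field.
Qed.

Lemma eq_maj G F G' F' : G =1 G' -> F =1 F' -> maj G F -> maj G' F'.
Proof. by move=> /funext -> /funext ->. Qed.

Lemma maj_cosh_sinh a b c d i : `|b| <= a -> `|d| <= c ->
  maj (fun x => a + c * spin R (x i)) (fun x => b + d * spin R (x i)).
Proof.
move=> /ler_normlP[ba ba'] /ler_normlP[dc dc']; split.
  apply: (@eq_pos (fun x => (a + b) + (c + d) * spin R (x i))) => [x|]; first ring.
  by apply: pos_add; [apply: pos_cst; lra|apply: posZ (pos_spin i); lra].
apply: (@eq_pos (fun x => (a - b) + (c - d) * spin R (x i))) => [x|]; first ring.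
by apply: pos_add; [apply: pos_cst; lra|apply: posZ (pos_spin i); lra].
Qed.

Lemma expR_spin c b : expR (c * spin R b) = coshR c + sinhR c * spin R b.
Proof. by have := expR_char c [:: 0%N] (fun=> b); rewrite /char big_seq1. Qed.

Lemma sinhR_norm c d : `|c| <= d -> `|sinhR c| <= sinhR d.
Proof.
move=> /ler_normlP[cd cd']; apply/ler_normlP; split; last exact: sinhR_le.
by rewrite -sinhRN sinhR_le.
Qed.

Lemma maj_expR_spin c d i : `|c| <= d ->
  maj (fun x => expR (d * spin R (x i))) (fun x => expR (c * spin R (x i))).
Proof.
move=> cd.
apply: (eq_maj _ _ (maj_cosh_sinh i (_ : `|coshR c| <= coshR d)
  (sinhR_norm cd))) => [x|x|]; rewrite ?expR_spin //.
by rewrite ger0_norm ?coshR_le // (le_trans ler01) ?coshR_ge1.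
Qed.

(** The constant coefficient cosh c - 1 is still nonnegative. Hence increments caused by a new
    factor, and not only values, can be compared. *)
Lemma maj_expR_spin_sub1 c d i : `|c| <= d ->
  maj (fun x => expR (d * spin R (x i)) - 1) (fun x => expR (c * spin R (x i)) - 1).
Proof.
move=> cd.
apply: (eq_maj _ _ (maj_cosh_sinh i (_ : `|coshR c - 1| <= coshR d - 1)
  (sinhR_norm cd))) => [x|x|]; rewrite ?expR_spin; try ring.
by rewrite ger0_norm ?lerB ?coshR_le // subr_ge0 coshR_ge1.
Qed.

Lemma maj_cst c : 0 <= c -> maj (fun=> c) (fun=> c).
Proof.
move=> c0; split; first by apply: pos_cst; exact: addr_ge0.
by apply: eq_pos (pos_cst (lexx 0)) => x; rewrite subrr.
Qed.

Lemma maj_expR_sum N (h h' : nat -> R) :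
  (forall i, (i < N)%N -> `|h i| <= h' i) ->
  maj (fun x => expR (\sum_(i < N) h' i * spin R (x i)))
      (fun x => expR (\sum_(i < N) h i * spin R (x i))).
Proof.
elim: N => [|N IH] hh.
  by apply: (eq_maj _ _ (maj_cst ler01)) => x; rewrite big_ord0 expR0.
apply: (eq_maj _ _ (majM (IH (fun i iN => hh i (ltnW iN)))
  (maj_expR_spin N (hh N (ltnSn N))))) => x; by rewrite big_ord_recr /= expRD.
Qed.

End Griffiths.

(** * Gibbs means on a block *)

Section IsingBlock.
Context {R : realType}.
Variable J : nat -> R.
Implicit Types (F G : (nat -> bool) -> R) (x y : nat -> bool) (N : nat).
Implicit Types (h : nat -> R).

Definition bond N x : R :=
  \sum_(j < N) \sum_(i < j) J (j - i)%N * (spin R (x i) * spin R (x j)).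

Definition lin N h x : R := \sum_(i < N) h i * spin R (x i).

Definition wgt N h x : R := expR (bond N x + lin N h x).

Lemma wgt_gt0 N h x : 0 < wgt N h x. Proof. exact: expR_gt0. Qed.

Lemma bond_scons N a x :
  bond N.+1 (scons a x) = bond N x + lin N (fun i => spin R a * J i.+1) x.
Proof.
rewrite /bond big_ord_recl big_ord0 add0r /lin -big_split; apply: eq_bigr => j _.
rewrite big_ord_recl addrC /= subn0; congr (_ + _); last ring.
Qed.

Lemma lin_scons N h a x :
  lin N.+1 h (scons a x) = h 0%N * spin R a + lin N (fun i => h i.+1) x.
Proof. by rewrite /lin big_ord_recl. Qed.

Lemma linD N h h' x : lin N (fun i => h i + h' i) x = lin N h x + lin N h' x.
Proof. by rewrite /lin -big_split; apply: eq_bigr => i _; rewrite mulrDl. Qed.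

Lemma eq_lin N h h' x x' :
  (forall i, (i < N)%N -> h i = h' i) -> (forall i, (i < N)%N -> x i = x' i) ->
  lin N h x = lin N h' x'.
Proof. by move=> hh xx; apply: eq_bigr => i _; rewrite hh ?xx. Qed.

Lemma eq_bond N x x' : (forall i, (i < N)%N -> x i = x' i) -> bond N x = bond N x'.
Proof.
move=> xx; apply: eq_bigr => j _; apply: eq_bigr => i _.
by rewrite !xx // (ltn_trans (ltn_ord i)).
Qed.

Lemma eq_wgt N h h' x : (forall i, (i < N)%N -> h i = h' i) ->
  wgt N h x = wgt N h' x.
Proof. by move=> hh; rewrite /wgt (eq_lin (h' := h') (x' := x)). Qed.

Lemma prefix_lin N h : prefix_fun N (lin N h).
Proof. by move=> x x' xx; exact: eq_lin. Qed.

Lemma prefix_wgt N h : prefix_fun N (wgt N h).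
Proof. by move=> x x' xx; rewrite /wgt (eq_bond xx) (prefix_lin h xx). Qed.

Lemma wgt_scons N h a x : wgt N.+1 h (scons a x) =
  expR (h 0%N * spin R a) * wgt N (fun i => h i.+1 + spin R a * J i.+1) x.
Proof. by rewrite /wgt bond_scons lin_scons linD -expRD; congr expR; ring. Qed.

Lemma wgt_last N h x : wgt N.+1 h x = expR (h N * spin R (x N)) *
  wgt N (fun i => h i + spin R (x N) * J (N - i)%N) x.
Proof.
rewrite /wgt linD -expRD; congr expR.
rewrite /bond /lin !big_ord_recr /=.
under [\sum_(i < N) J (N - i)%N * _]eq_bigr do rewrite mulrA [_ * spin R (x N)]mulrC mulrA.
ring.
Qed.

Lemma wgtD N h h' x : wgt N (fun i => h i + h' i) x = wgt N h x * expR (lin N h' x).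
Proof. by rewrite /wgt linD addrA -expRD. Qed.

Lemma wgt_flip N h x : wgt N h (spin_flip x) = wgt N (fun i => - h i) x.
Proof.
rewrite /wgt; congr (expR (_ + _)).
  by apply: eq_bigr => j _; apply: eq_bigr => i _; rewrite /spin_flip !spinN mulrNN.
by apply: eq_bigr => i _; rewrite spinN; ring.
Qed.

Lemma rev_prefix_ord N x (i : 'I_N) : rev_prefix N x (rev_ord i) = x i.
Proof.
rewrite /rev_prefix ltn_ord.
by rewrite -[X in x X]/(nat_of_ord (rev_ord (rev_ord i))) rev_ordK.
Qed.

Lemma bond_rev N x : bond N (rev_prefix N x) = bond N x.
Proof.
have E y : bond N y = \sum_(j < N) \sum_(i < N)
    if (i < j)%N then J (j - i)%N * (spin R (y i) * spin R (y j)) else 0.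
  apply: eq_bigr => j _; rewrite -big_mkcond.
  by rewrite (big_ord_widen N (fun i => J (j - i)%N *
    (spin R (y i) * spin R (y j)))) // ltnW.
rewrite !E exchange_big (reindex_inj rev_ord_inj); apply: eq_bigr => j _.
rewrite (reindex_inj rev_ord_inj); apply: eq_bigr => i _.
rewrite !rev_prefix_ord [spin R (x i) * _]mulrC /= ltn_sub2lE // ltnS.
have iN := ltn_ord i; have jN := ltn_ord j.
by have -> : (N - i.+1 - (N - j.+1) = j - i)%N by lia.
Qed.

Lemma lin_rev N h x :
  lin N h (rev_prefix N x) = lin N (fun i => h (N - i.+1)%N) x.
Proof.
rewrite /lin (reindex_inj rev_ord_inj); apply: eq_bigr => i _.
by rewrite rev_prefix_ord.
Qed.

End IsingBlock.

Definition increasing_cfg (R : realType) (F : (nat -> bool) -> R) :=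
  forall x x' : nat -> bool, (forall i, x i ==> x' i) -> F x <= F x'.

Section GibbsMeans.
Context {R : realType} {J : nat -> R}.
Implicit Types (F G : (nat -> bool) -> R) (x y : nat -> bool) (N : nat).
Implicit Types (h : nat -> R).

Definition Zsum N h F := psum N all_plus (fun x => wgt J N h x * F x).

Definition mean N h F := Zsum N h F / Zsum N h (fun=> 1).

Lemma Zsum_gt0 N h F : (forall x, 0 < F x) -> 0 < Zsum N h F.
Proof. by move=> F0; apply: psum_gt0 => x; rewrite mulr_gt0 ?wgt_gt0. Qed.

Lemma Z_gt0 N h : 0 < Zsum N h (fun=> 1).
Proof. exact: Zsum_gt0. Qed.

Lemma Z_neq0 N h : Zsum N h (fun=> 1) != 0.
Proof. by rewrite gt_eqF ?Z_gt0. Qed.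

Lemma ZsumE N h F : Zsum N h F = Zsum N h (fun=> 1) * mean N h F.
Proof. by rewrite mulrC divfK ?Z_neq0. Qed.

Lemma eq_Zsum N h h' F F' : (forall i, (i < N)%N -> h i = h' i) -> F =1 F' ->
  Zsum N h F = Zsum N h' F'.
Proof. by move=> hh FF; apply: eq_psum => x; rewrite (eq_wgt _ _ hh) FF. Qed.

Lemma eq_mean N h h' F F' : (forall i, (i < N)%N -> h i = h' i) -> F =1 F' ->
  mean N h F = mean N h' F'.
Proof. by move=> hh FF; rewrite /mean (eq_Zsum hh FF) (eq_Zsum hh (frefl _)). Qed.

Lemma ZsumD N h F G : Zsum N h (fun x => F x + G x) = Zsum N h F + Zsum N h G.
Proof. by rewrite /Zsum -psumD; apply: eq_psum => x; rewrite mulrDr. Qed.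

Lemma ZsumZ N h c F : Zsum N h (fun x => c * F x) = c * Zsum N h F.
Proof. by rewrite /Zsum -psumZ; apply: eq_psum => x; ring. Qed.

Lemma meanD N h F G : mean N h (fun x => F x + G x) = mean N h F + mean N h G.
Proof. by rewrite /mean ZsumD mulrDl. Qed.

Lemma meanZ N h c F : mean N h (fun x => c * F x) = c * mean N h F.
Proof. by rewrite /mean ZsumZ mulrA. Qed.

Lemma meanN N h F : mean N h (fun x => - F x) = - mean N h F.
Proof. by rewrite -mulN1r -meanZ; apply: eq_mean => // x; rewrite mulN1r. Qed.

Lemma meanB N h F G : mean N h (fun x => F x - G x) = mean N h F - mean N h G.
Proof. by rewrite meanD meanN. Qed.

Lemma mean_cst N h c : mean N h (fun=> c) = c.
Proof.
rewrite -[RHS]mulr1 -[X in _ = _ * X](divff (Z_neq0 N h)) mulrA -ZsumZ.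
by congr (_ / _); apply: eq_Zsum => // x; rewrite mulr1.
Qed.

Lemma mean_sum N h n (F : nat -> (nat -> bool) -> R) :
  mean N h (fun x => \sum_(i < n) F i x) = \sum_(i < n) mean N h (F i).
Proof.
elim: n => [|n IH].
  by rewrite big_ord0 -[RHS](mean_cst N h); apply: eq_mean => // x; rewrite big_ord0.
rewrite big_ord_recr /= -IH -[RHS]meanD; apply: eq_mean => // x.
by rewrite big_ord_recr.
Qed.

Lemma le_mean N h F G : (forall x, F x <= G x) -> mean N h F <= mean N h G.
Proof.
move=> FG; rewrite /mean ler_pM2r ?invr_gt0 ?Z_gt0 //.
by apply: ler_psum => x; rewrite ler_pM2l ?wgt_gt0.
Qed.

Lemma mean_ge0 N h F : (forall x, 0 <= F x) -> 0 <= mean N h F.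
Proof. by move=> F0; rewrite -[leLHS](mean_cst N h); exact: le_mean. Qed.

Lemma mean_gt0 N h F : (forall x, 0 < F x) -> 0 < mean N h F.
Proof. by move=> F0; rewrite divr_gt0 ?Zsum_gt0. Qed.

Lemma Zsum_tilt N h h' F :
  Zsum N (fun i => h i + h' i) F = Zsum N h (fun x => F x * expR (lin N h' x)).
Proof. by apply: eq_psum => x; rewrite wgtD; ring. Qed.

Lemma mean_tilt N h h' F : mean N (fun i => h i + h' i) F =
  mean N h (fun x => F x * expR (lin N h' x)) / mean N h (fun x => expR (lin N h' x)).
Proof.
rewrite /mean !Zsum_tilt.
rewrite (eq_Zsum (h := h) (h' := h) (F' := fun x => expR (lin N h' x)) _
  (fun x => mul1r _)) //.
have : Zsum N h (fun x => expR (lin N h' x)) != 0.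
  by rewrite gt_eqF // Zsum_gt0 // => x; exact: expR_gt0.
by have := Z_neq0 N h; move=> *; field; apply/andP.
Qed.

Lemma Zsum_scons N h F : Zsum N.+1 h F =
  expR (h 0%N) * Zsum N (fun i => h i.+1 + J i.+1) (F \o scons true) +
  expR (- h 0%N) * Zsum N (fun i => h i.+1 - J i.+1) (F \o scons false).
Proof.
rewrite /Zsum /=; congr (_ + _); rewrite -psumZ; apply: eq_psum => x /=.
  rewrite wgt_scons /spin mulr1 mulrA; congr (_ * _ * _).
  by apply: eq_wgt => i _; rewrite mul1r.
rewrite wgt_scons /spin mulrN1 mulrA; congr (_ * _ * _).
by apply: eq_wgt => i _; rewrite mulN1r.
Qed.

Lemma Zsum_last N h F : prefix_fun N F -> Zsum N.+1 h F =
  expR (h N) * Zsum N (fun i => h i + J (N - i)%N) F +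
  expR (- h N) * Zsum N (fun i => h i - J (N - i)%N) F.
Proof.
move=> dF; rewrite /Zsum psum_last.
have E b : psum N (scons b all_plus) (fun x => wgt J N.+1 h x * F x) =
    expR (h N * spin R b) * psum N all_plus
      (fun x => wgt J N (fun i => h i + spin R b * J (N - i)%N) x * F x).
  rewrite -psumZ -(psum_base (scons b all_plus)); last first.
    by move=> x x' xx'; rewrite (prefix_wgt _ _ xx') (dF _ _ xx').
  apply: eq_psum_in => x /(_ 0%N); rewrite addn0 /= => xN.
  by rewrite wgt_last xN mulrA.
rewrite !E /spin mulr1 mulrN1; congr (_ * _ + _ * _); apply: eq_psum => x.
  by congr (_ * _); apply: eq_wgt => i _; rewrite mul1r.
by congr (_ * _); apply: eq_wgt => i _; rewrite mulN1r.
Qed.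

Lemma mean_flip N h F : prefix_fun N F ->
  mean N h (F \o spin_flip) = mean N (fun i => - h i) F.
Proof.
have E G : prefix_fun N G ->
    Zsum N h (G \o spin_flip) = Zsum N (fun i => - h i) G.
  move=> dG; rewrite /Zsum.
  rewrite -[RHS](psum_base (spin_flip all_plus)); last first.
    by move=> x x' xx'; rewrite (prefix_wgt _ _ xx') (dG _ _ xx').
  rewrite -[RHS]psum_flip; apply: eq_psum => x /=; rewrite wgt_flip.
  by congr (_ * _); apply: eq_wgt => i _; rewrite opprK.
by move=> dF; rewrite /mean E // -(E (fun=> 1)).
Qed.

Lemma mean_rev N h F : prefix_fun N F ->
  mean N h (F \o rev_prefix N) = mean N (fun i => h (N - i.+1)%N) F.
Proof.
have E G : prefix_fun N G ->
    Zsum N h (G \o rev_prefix N) = Zsum N (fun i => h (N - i.+1)%N) G.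
  move=> dG; rewrite /Zsum -[RHS]psum_rev; last first.
    by move=> x x' xx'; rewrite (prefix_wgt _ _ xx') (dG _ _ xx').
  apply: eq_psum => x /=; congr (_ * _).
  rewrite /wgt bond_rev lin_rev; congr (expR (_ + _)).
  by apply: eq_lin => // i iN; congr h; lia.
by move=> dF; rewrite /mean E // -(E (fun=> 1)).
Qed.

Lemma mean_scons N h F :
  let A := expR (h 0%N) * Zsum N (fun i => h i.+1 + J i.+1) (fun=> 1) in
  let B := expR (- h 0%N) * Zsum N (fun i => h i.+1 - J i.+1) (fun=> 1) in
  mean N.+1 h F =
  (A * mean N (fun i => h i.+1 + J i.+1) (F \o scons true) +
   B * mean N (fun i => h i.+1 - J i.+1) (F \o scons false)) / (A + B).
Proof.
move=> A B; rewrite {1}/mean Zsum_scons [Zsum N.+1 _ (fun=> 1)]Zsum_scons.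
by rewrite (ZsumE _ _ (F \o scons true)) (ZsumE _ _ (F \o scons false)) !mulrA.
Qed.

End GibbsMeans.

(** * Correlation inequalities *)

Section Correlations.
Context {R : realType} {J : nat -> R}.
Hypothesis J_ge0 : forall k, 0 <= J k.
Implicit Types (F G : (nat -> bool) -> R) (x y : nat -> bool) (N : nat).
Implicit Types (h : nat -> R).

Local Notation mean := (mean (J := J)).
Local Notation Zsum := (Zsum (J := J)).

Lemma le_spin a b : a ==> b -> spin R a <= spin R b.
Proof. by case: a; case: b => //= _; rewrite /spin; lra. Qed.

Lemma increasing_lin N h : (forall i, (i < N)%N -> 0 <= h i) ->
  increasing_cfg (lin N h).
Proof.
move=> h0 x x' xx; apply: ler_sum => i _.
by rewrite ler_wpM2l ?h0 // le_spin.
Qed.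

Lemma increasing_expR F : increasing_cfg F -> increasing_cfg (fun x => expR (F x)).
Proof. by move=> incF x x' xx; rewrite ler_expR incF. Qed.

Lemma increasing_scons F a : increasing_cfg F -> increasing_cfg (F \o scons a).
Proof. by move=> incF x x' xx; apply: incF => -[|i]//=; exact: implybb. Qed.

Lemma increasing_spin i : increasing_cfg (fun x => spin R (x i)).
Proof. by move=> x x' xx; exact: le_spin. Qed.

(** Raising the fields reweights by an increasing function, to which FKG applies. The length is
    fixed because FKG on [N.+1] sites relies on monotonicity on [N] sites. *)
Let mono_of_fkg N :
  (forall h F G, increasing_cfg F -> increasing_cfg G ->
    mean N h F * mean N h G <= mean N h (fun x => F x * G x)) ->
  forall h h' F, (forall i, (i < N)%N -> h i <= h' i) -> increasing_cfg F ->
    mean N h F <= mean N h' F.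
Proof.
move=> fkgN h h' F hh incF.
pose e x := expR (lin N (fun i => h' i - h i) x).
have -> : mean N h' F = mean N (fun i => h i + (h' i - h i)) F.
  by apply: eq_mean => // i _; ring.
rewrite mean_tilt ler_pdivlMr; last by apply: mean_gt0 => x; exact: expR_gt0.
apply: fkgN => //; apply/increasing_expR/increasing_lin => i iN.
by rewrite subr_ge0 hh.
Qed.

(** Conditioning on the first spin splits the covariance into the average of the conditional
    covariances and the covariance of the conditional means. The former are nonnegative by
    induction; the latter is nonnegative because, with nonnegative couplings, a plus first spin
    raises both conditional means. *)
Lemma mean_fkg N h F G : increasing_cfg F -> increasing_cfg G ->
  mean N h F * mean N h G <= mean N h (fun x => F x * G x).
Proof.
elim: N h F G => [|N IH] h F G incF incG.
  have E H : mean 0 h H = H all_plus.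
    by rewrite /mean /Zsum /= mulr1 mulrC mulKf // gt_eqF ?wgt_gt0.
  by rewrite !E.
have mono := mono_of_fkg IH.
rewrite !mean_scons.
set A := _ * Zsum _ _ _; set B := _ * Zsum _ _ _.
have A0 : 0 < A by rewrite mulr_gt0 ?expR_gt0 ?Z_gt0.
have B0 : 0 < B by rewrite mulr_gt0 ?expR_gt0 ?Z_gt0.
set F1 := mean _ _ (F \o scons true); set F0 := mean _ _ (F \o scons false).
set G1 := mean _ _ (G \o scons true); set G0 := mean _ _ (G \o scons false).
have step H : increasing_cfg H ->
    mean N (fun i => h i.+1 - J i.+1) H <= mean N (fun i => h i.+1 + J i.+1) H.
  by apply: mono => i _; have := J_ge0 i.+1; lra.
have F01 : F0 <= F1.
  apply: le_trans (step _ (increasing_scons true incF)).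
  by apply: le_mean => x /=; apply: incF => -[|i] /=; rewrite ?implybb.
have G01 : G0 <= G1.
  apply: le_trans (step _ (increasing_scons true incG)).
  by apply: le_mean => x /=; apply: incG => -[|i] /=; rewrite ?implybb.
have FG1 := IH _ _ _ (increasing_scons true incF) (increasing_scons true incG) :
  F1 * G1 <= _.
have FG0 := IH _ _ _ (increasing_scons false incF) (increasing_scons false incG) :
  F0 * G0 <= _.
apply: (@le_trans _ _ ((A * (F1 * G1) + B * (F0 * G0)) / (A + B))); last first.
  by rewrite ler_pM2r ?invr_gt0 ?addr_gt0 // lerD // ler_pM2l.
rewrite -subr_ge0.
have -> : (A * (F1 * G1) + B * (F0 * G0)) / (A + B) -
    (A * F1 + B * F0) / (A + B) * ((A * G1 + B * G0) / (A + B)) =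
    A * B * ((F1 - F0) * (G1 - G0)) / (A + B) ^+ 2.
  by field; rewrite gt_eqF // addr_gt0.
apply: divr_ge0 (sqr_ge0 _); apply: mulr_ge0; first exact: ltW (mulr_gt0 A0 B0).
by rewrite mulr_ge0 ?subr_ge0.
Qed.

Lemma mean_mono N h h' F : (forall i, (i < N)%N -> h i <= h' i) ->
  increasing_cfg F -> mean N h F <= mean N h' F.
Proof. by apply: mono_of_fkg => *; exact: mean_fkg. Qed.

(** The left side averages the conditional means given the first spin; the one for a plus spin,
    which adds the fields [J i.+1], is the larger. *)
Lemma mean_shift_le N h F : increasing_cfg F ->
  mean N.+1 h (fun x => F (fun i => x i.+1)) <=
  mean N (fun i => h i.+1 + J i.+1) F.
Proof.
move=> incF; rewrite mean_scons /=.
set A := _ * Zsum _ _ _; set B := _ * Zsum _ _ _.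
have A0 : 0 < A by rewrite mulr_gt0 ?expR_gt0 ?Z_gt0.
have B0 : 0 < B by rewrite mulr_gt0 ?expR_gt0 ?Z_gt0.
rewrite ler_pdivrMr ?addr_gt0 // mulrDr [_ * A]mulrC [_ * B]mulrC lerD2l.
rewrite ler_pM2l //; apply: mean_mono => // i _.
by have := J_ge0 i.+1; lra.
Qed.

Lemma mean_last N h F : prefix_fun N F ->
  let A := expR (h N) * Zsum N (fun i => h i + J (N - i)%N) (fun=> 1) in
  let B := expR (- h N) * Zsum N (fun i => h i - J (N - i)%N) (fun=> 1) in
  mean N.+1 h F =
  (A * mean N (fun i => h i + J (N - i)%N) F +
   B * mean N (fun i => h i - J (N - i)%N) F) / (A + B).
Proof.
move=> dF A B; rewrite {1}/mean !Zsum_last // [X in X * _ + _]/=.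
by rewrite (ZsumE _ _ F) (ZsumE _ (fun i => h i - J (N - i)%N) F) !mulrA.
Qed.

Lemma mean_last_le N h F : prefix_fun N F -> increasing_cfg F ->
  mean N.+1 h F <= mean N (fun i => h i + J (N - i)%N) F.
Proof.
move=> dF incF; rewrite mean_last //.
set A := _ * Zsum _ _ _; set B := _ * Zsum _ _ _.
have A0 : 0 < A by rewrite mulr_gt0 ?expR_gt0 ?Z_gt0.
have B0 : 0 < B by rewrite mulr_gt0 ?expR_gt0 ?Z_gt0.
rewrite ler_pdivrMr ?addr_gt0 // mulrDr [_ * A]mulrC [_ * B]mulrC lerD2l.
rewrite ler_pM2l //; apply: mean_mono => // i _.
by have := J_ge0 (N - i)%N; lra.
Qed.

Lemma ferro_energy N h : (forall i, (i < N)%N -> 0 <= h i) ->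
  ferro (fun x => bond J N x + lin N h x).
Proof.
move=> h0; apply: ferro_add.
  apply: (@ferro_sum _ N (fun j x =>
    \sum_(i < j) J (j - i)%N * (spin R (x i) * spin R (x j)))) => j _.
  apply: (@ferro_sum _ j (fun i x => J (j - i)%N * (spin R (x i) * spin R (x j)))) => i _.
  exact: ferro_spin2.
apply: (@ferro_sum _ N (fun i x => h i * spin R (x i))) => i iN.
by apply: ferro_spin; exact: h0.
Qed.

Lemma mean_pos_ge0 N h F : (forall i, (i < N)%N -> 0 <= h i) -> pos_char F ->
  0 <= mean N h F.
Proof.
move=> h0 pF; rewrite divr_ge0 ?(ltW (Z_gt0 _ _)) //; apply: psum_pos.
by apply: pos_mul => //; apply: pos_expR; exact: ferro_energy.
Qed.

(** The coupling [G] of the new site to the block is a factor in the cone, so switching it on raises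
    the mean of [F] by Griffiths' second inequality. With the coupling off, the new site only
    contributes a constant factor. *)
Lemma mean_add_site N h F : (forall i, (i < N.+1)%N -> 0 <= h i) -> pos_char F ->
  mean N (fun i => h i.+1) F <= mean N.+1 h (fun x => F (fun i => x i.+1)).
Proof.
move=> h0 pF.
pose P x : R := h 0%N * spin R (x 0%N) +
  (bond J N (fun i => x i.+1) + lin N (fun i => h i.+1) (fun i => x i.+1)).
pose G x := expR (\sum_(i < N) J i.+1 * (spin R (x 0%N) * spin R (x i.+1))).
have fP : ferro P.
  apply: ferro_add; first by apply: ferro_spin; exact: h0.
  apply: (@ferro_comp_shift _ (fun x => bond J N x + lin N (fun i => h i.+1) x)).
  by apply: ferro_energy => i iN; exact: h0.
have pG : pos_char G.
  apply: pos_expR.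
  apply: (@ferro_sum _ N (fun i x => J i.+1 * (spin R (x 0%N) * spin R (x i.+1)))) => i _.
  exact: ferro_spin2.
have wE a x : wgt J N.+1 h (scons a x) = expR (P (scons a x)) * G (scons a x).
  rewrite wgt_scons wgtD /P /G /wgt -!expRD /= !addrA; congr (expR (_ + _)).
  by apply: eq_bigr => i _; ring.
have ZE H : Zsum N.+1 h H = psum N.+1 all_plus (fun x => expR (P x) * (H x * G x)).
  by congr (_ + _); apply: eq_psum => x /=; rewrite wE; ring.
have PE H : psum N.+1 all_plus (fun x => expR (P x) * H (fun i => x i.+1)) =
    (expR (h 0%N) + expR (- h 0%N)) * Zsum N (fun i => h i.+1) H.
  rewrite mulrDl /=; congr (_ + _); rewrite -psumZ; apply: eq_psum => x;
    by rewrite /P /= expRD /spin ?mulr1 ?mulrN1 mulrA.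
have c0 : 0 < expR (h 0%N) + expR (- h 0%N) by rewrite addr_gt0 ?expR_gt0.
have := griffiths2 N.+1 fP (pos_comp_shift pF) pG.
have -> : psum N.+1 all_plus (fun x => expR (P x)) =
    (expR (h 0%N) + expR (- h 0%N)) * Zsum N (fun i => h i.+1) (fun=> 1).
  by rewrite -(PE (fun=> 1)); apply: eq_psum => x; rewrite mulr1.
have -> : psum N.+1 all_plus (fun x => expR (P x) * G x) = Zsum N.+1 h (fun=> 1).
  by rewrite ZE; apply: eq_psum => x; rewrite mul1r.
rewrite PE -ZE -!mulrA ler_pM2l // => le.
rewrite /mean ler_pdivrMr ?Z_gt0 // mulrAC ler_pdivlMr ?Z_gt0 //.
by rewrite [leRHS]mulrC.
Qed.

(** The difference of the field factors has nonnegative character coefficients, and characters have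
    nonnegative means in the block without fields. *)
Lemma le_Z_maj N h h' : (forall i, (i < N)%N -> `|h i| <= h' i) ->
  Zsum N h (fun=> 1) <= Zsum N h' (fun=> 1).
Proof.
move=> hh; rewrite -subr_ge0 -psumB.
have [_ pm] := maj_expR_sum hh.
have fB : ferro (fun x => bond J N x + lin N (fun=> 0) x) by apply: ferro_energy.
apply: le_trans (psum_pos N (pos_mul (pos_expR fB) pm)) _.
rewrite le_eqVlt; apply/orP; left; apply/eqP; apply: eq_psum => x.
have E k : wgt J N k x = expR (bond J N x + lin N (fun=> 0) x) * expR (lin N k x).
  rewrite -[expR (_ + _)]/(wgt J N (fun=> 0) x) -wgtD.
  by apply: eq_wgt => i _; rewrite add0r.
by rewrite !mulr1 !E -mulrBr.
Qed.

End Correlations.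

(** * Plus boundary conditions on the left *)

Section PlusLeft.
Context {R : realType} {J r : nat -> R}.
Hypothesis J_ge0 : forall k, 0 <= J k.
Hypothesis r_ge0 : forall k, 0 <= r k.
Hypothesis r_rec : forall k, r k = J k.+1 + r k.+1.
Hypothesis r_cvg0 : r @ \oo --> (0 : R).
Implicit Types (F G : (nat -> bool) -> R) (x y : nat -> bool) (N : nat).

Local Notation mean := (mean (J := J)).
Local Notation Zsum := (Zsum (J := J)).

(* Fields on a block of [N] sites when all sites to its left are plus and all
   sites to its right are equal to [t]. *)
Definition bc (t : R) N i : R := r i + t * r (N - i.+1)%N.

Definition right_plus N i : R := r (N - i.+1)%N.

Lemma r_le k l : (k <= l)%N -> r l <= r k.
Proof.
elim: l => [|l IH]; first by rewrite leqn0 => /eqP ->.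
rewrite leq_eqVlt => /orP[/eqP -> //|]; rewrite ltnS => /IH; apply: le_trans.
by rewrite [leRHS]r_rec lerDr.
Qed.

Lemma sum_J_r N : \sum_(i < N) J i.+1 = r 0 - r N.
Proof.
elim: N => [|N IH]; first by rewrite big_ord0 subrr.
by rewrite big_ord_recr /= IH [r N]r_rec; ring.
Qed.

(** The reweighting of a block when its nearest left neighbour is turned from plus to minus. *)
Definition first_flip N x : R := expR (lin N (fun i => - 2 * J i.+1) x).

(** The block grows at its left end. A plus spin there joins the plus half-line, and since
    [r i = J i.+1 + r i.+1] the other sites see the old boundary condition; a minus spin costs the
    factor [first_flip]. *)
Lemma Z_bc_rec t N : Zsum N.+1 (bc t N.+1) (fun=> 1) =
  Zsum N (bc t N) (fun=> 1) * (expR (r 0 + t * r N) +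
    expR (- (r 0 + t * r N)) * mean N (bc t N) (first_flip N)).
Proof.
rewrite Zsum_scons.
have -> : Zsum N (fun i => bc t N.+1 i.+1 + J i.+1) ((fun=> 1) \o scons true) =
    Zsum N (bc t N) (fun=> 1).
  by apply: eq_Zsum => // i _; rewrite /bc subSS [r i]r_rec; ring.
have -> : Zsum N (fun i => bc t N.+1 i.+1 - J i.+1) ((fun=> 1) \o scons false) =
    Zsum N (bc t N) (first_flip N).
  rewrite (eq_Zsum (h' := fun i => bc t N i + - 2 * J i.+1)
    (F' := fun=> 1) _ _) // => [|i _]; last by rewrite /bc subSS [r i]r_rec; ring.
  by rewrite Zsum_tilt; apply: eq_Zsum => // x; rewrite mul1r.
have -> : bc t N.+1 0%N = r 0 + t * r N by rewrite /bc subSS subn0.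
by rewrite (ZsumE _ _ (first_flip N)); ring.
Qed.

Lemma first_flip_le N x : first_flip N x <= expR (2 * r 0).
Proof.
rewrite ler_expR; apply: le_trans (_ : \sum_(i < N) 2 * J i.+1 <= _).
  apply: ler_sum => i _; have := J_ge0 i.+1.
  by case: (x i); rewrite /spin; lra.
by rewrite -mulr_sumr sum_J_r; have := r_ge0 N; lra.
Qed.

Lemma first_flip_ge N x : expR (- (2 * r 0)) <= first_flip N x.
Proof.
rewrite ler_expR; apply: (@le_trans _ _ (\sum_(i < N) (- 2 * J i.+1))).
  by rewrite -mulr_sumr sum_J_r; have := r_ge0 N; lra.
apply: ler_sum => i _; have := J_ge0 i.+1.
by case: (x i); rewrite /spin; lra.
Qed.

(** The quotient of the partition functions of lengths [N.+1] and [N], by [Z_bc_rec]. *)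
Definition Z_ratio t N := expR (r 0 + t * r N) +
  expR (- (r 0 + t * r N)) * mean N (bc t N) (first_flip N).

Lemma Z_ratio_gt0 t N : 0 < Z_ratio t N.
Proof.
apply: addr_gt0; first exact: expR_gt0.
apply: mulr_gt0; first exact: expR_gt0.
by apply: mean_gt0 => x; exact: expR_gt0.
Qed.

Lemma Z_ratio_le N : Z_ratio 1 N <= 2 * expR (2 * r 0).
Proof.
rewrite /Z_ratio mul1r mulr2n mulrDl mul1r; apply: lerD.
  by rewrite ler_expR; have := r_le (leq0n N); lra.
rewrite -[leRHS]mul1r; apply: ler_pM.
- exact: expR_ge0.
- by apply: mean_ge0 => x; exact: expR_ge0.
- by rewrite -expR0 ler_expR; have := r_ge0 0; have := r_ge0 N; lra.
- by rewrite -[leRHS](mean_cst N (bc 1 N) (J := J)); apply: le_mean => x; exact: first_flip_le.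
Qed.

Lemma le_Z_bc N : Zsum N (bc (-1) N) (fun=> 1) <= Zsum N (bc 1 N) (fun=> 1).
Proof.
apply: le_Z_maj => // i _; rewrite /bc.
have := r_ge0 i; have := r_ge0 (N - i.+1)%N => *.
by apply/ler_normlP; split; lra.
Qed.

(* If adding a site kept on being cheaper with plus than with minus boundary
   spins, the ratio of the two partition functions would grow geometrically. *)
Lemma Z_ratio_close (e : R) N0 : 0 < e ->
  exists2 N, (N0 <= N)%N & Z_ratio (-1) N < Z_ratio 1 N + e.
Proof.
move=> e0; apply: contrapT => H.
have {}H N : (N0 <= N)%N -> Z_ratio 1 N + e <= Z_ratio (-1) N.
  by move=> N0N; rewrite leNgt; apply/negP => ?; apply: H; exists N.
pose C := 2 * expR (2 * r 0); have C0 : 0 < C by rewrite mulr_gt0 ?expR_gt0.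
pose a k := Zsum (N0 + k) (bc (-1) (N0 + k)) (fun=> 1) /
            Zsum (N0 + k) (bc 1 (N0 + k)) (fun=> 1).
have a1 k : a k <= 1 by rewrite ler_pdivrMr ?Z_gt0 // mul1r le_Z_bc.
have a_gt0 k : 0 < a k by rewrite divr_gt0 ?Z_gt0.
(* As [C] bounds [Z_ratio 1], each new site multiplies [a] by at least 1 + e/C. The linear growth
   drawn from this already contradicts [a k <= 1]. *)
have aS k : a k + a k * (e / C) <= a k.+1.
  rewrite /a addnS !Z_bc_rec -/(Z_ratio _ _) -/(Z_ratio _ _).
  have rp0 := Z_ratio_gt0 1 (N0 + k).
  rewrite -mulf_div -[X in X + _]mulr1 -mulrDr ler_pM2l; last exact: a_gt0.
  rewrite ler_pdivlMr // mulrDl mul1r.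
  apply: le_trans (H (N0 + k)%N (leq_addr _ _)); rewrite lerD2l.
  by rewrite mulrAC ler_pdivrMr // ler_pM2l // Z_ratio_le.
have lin k : k%:R * (a 0%N * (e / C)) <= a k.
  elim: k => [|k IH]; first by rewrite mul0r ltW.
  apply: le_trans (aS k); rewrite -natr1 mulrDl mul1r lerD // ler_pM2r ?divr_gt0 //.
  elim: k {IH} => [//|k IH]; apply: le_trans (le_trans IH _) (aS k).
  by rewrite lerDl; exact: mulr_ge0 (ltW (a_gt0 k)) (ltW (divr_gt0 e0 C0)).
have d0 : 0 < a 0%N * (e / C) by exact: mulr_gt0 (a_gt0 0%N) (divr_gt0 e0 C0).
have := archi_boundP (ltW (divr_gt0 ltr01 d0)).
rewrite ltr_pdivrMr //; set n := Num.bound _ => lt1.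
have := le_trans (lin n) (a1 n).
by rewrite leNgt lt1.
Qed.

(** [first_flip] is decreasing, and its slope in spin [j] is at least [2 * J j.+1] times its lower
    bound. Monotonicity of the remainder turns a bound on the change of the mean of [first_flip]
    into one on the change of the mean of spin [j]. *)
Lemma first_flip_lin j N : (j < N)%N ->
  increasing_cfg (fun x => - first_flip N x -
                    2 * J j.+1 * expR (- (2 * r 0)) * spin R (x j)).
Proof.
move=> jN x x' xx; pose c := expR (- (2 * r 0)).
have c0 : 0 < c by exact: expR_gt0.
have dec : lin N (fun i => - 2 * J i.+1) x' +
    2 * J j.+1 * (spin R (x' j) - spin R (x j)) <= lin N (fun i => - 2 * J i.+1) x.
  rewrite /lin (bigD1 (Ordinal jN)) //= [leRHS](bigD1 (Ordinal jN)) //=.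
  rewrite addrAC; apply: lerD; first by rewrite le_eqVlt; apply/orP; left; apply/eqP; ring.
  apply: ler_sum => i _; have := J_ge0 i.+1; have := le_spin (R := R) (xx i).
  by move=> *; nra.
have s0 : 0 <= spin R (x' j) - spin R (x j) by rewrite subr_ge0 le_spin.
have u0 : 0 <= 2 * J j.+1 * (spin R (x' j) - spin R (x j)).
  by rewrite mulr_ge0 // mulr_ge0.
have G' := first_flip_ge N x'; rewrite -/c in G'.
suff : first_flip N x' + c * (2 * J j.+1 * (spin R (x' j) - spin R (x j))) <=
    first_flip N x by rewrite -/c; nra.
apply: (@le_trans _ _ (first_flip N x' *
    expR (2 * J j.+1 * (spin R (x' j) - spin R (x j))))); last first.
  by rewrite -expRD ler_expR.
set u := _ * (_ - _) in u0 *.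
apply: (@le_trans _ _ (first_flip N x' * (1 + u))); last first.
  by rewrite ler_pM2l ?expR_gt0 // expR_ge1Dx.
by rewrite mulrDr mulr1 lerD2l ler_wpM2r.
Qed.

Lemma spin_bc_close j (e : R) N0 : 0 < J j.+1 -> 0 < e ->
  exists N, [/\ (N0 <= N)%N, (j < N)%N &
    mean N (bc 1 N) (fun x => spin R (x j)) -
    mean N (bc (-1) N) (fun x => spin R (x j)) < e].
Proof.
move=> Jj e0; pose E := expR (r 0); have E0 : 0 < E by exact: expR_gt0.
pose c := 2 * J j.+1 * expR (- (2 * r 0)).
have c0 : 0 < c by rewrite !mulr_gt0 ?expR_gt0.
(* The gap between the two values of [Z_ratio] contributes [e1], and the far right boundary, through
   [r N], contributes [E * e1]. The sum is multiplied by [E / c] on the way to the spin means. *)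
pose e1 := e * c / (E * (1 + E)).
have e10 : 0 < e1.
  exact: divr_gt0 (mulr_gt0 e0 c0) (mulr_gt0 E0 (addr_gt0 ltr01 E0)).
have cvgE : (fun n => expR (r n) - expR (- r n)) @ \oo --> (0 : R).
  have e0r : expR (r n) @[n --> \oo] --> expR (0 : R).
    exact: continuous_cvg (@continuous_expR _ _) r_cvg0.
  have e0N : expR (- r n) @[n --> \oo] --> expR (- 0 : R).
    by apply: continuous_cvg (@continuous_expR _ _) _; exact: cvgN.
  have -> : (0 : R) = expR 0 - expR (- 0) by rewrite oppr0 subrr.
  exact: cvgB e0r e0N.
have [N1 _ HN1] := @cvgr_lt _ _ _ _ _ _ cvgE _ e10.
have [N N1N Nclose] := Z_ratio_close (maxn (maxn N0 N1) j.+1) e10.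
have {N1N} [N0N N1N jN] : [/\ (N0 <= N)%N, (N1 <= N)%N & (j < N)%N].
  by move: N1N; rewrite !geq_max => /andP[/andP[-> ->] ->].
exists N; split => //.
have := HN1 N N1N; move: Nclose; rewrite /= /Z_ratio !mulN1r !mul1r.
set gm := mean N (bc (-1) N) _; set gp := mean N (bc 1 N) _.
set sp := mean N (bc 1 N) _; set sm := mean N (bc (-1) N) _.
have gm0 : 0 <= gm by apply: mean_ge0 => x; exact: expR_ge0.
have gp0 : 0 <= gp by apply: mean_ge0 => x; exact: expR_ge0.
have gs : c * (sp - sm) <= gm - gp.
  have /(mean_mono J_ge0) : forall i, (i < N)%N -> bc (-1) N i <= bc 1 N i.
    by move=> i _; rewrite /bc; have := r_ge0 (N - i.+1)%N; lra.
  move=> /(_ _ (first_flip_lin jN)); rewrite !meanB !meanN !meanZ -/c -/gm -/gp -/sp -/sm; lra.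
have q1 : 1 <= expR (r N) by rewrite -expR0 ler_expR.
have q2 : expR (- r N) <= 1 by rewrite -expR0 ler_expR oppr_le0.
set q := expR (r N) in q1 *; set q' := expR (- r N) in q2 *.
have -> : expR (r 0 - r N) = E * q' by rewrite expRD.
have -> : expR (r 0 + r N) = E * q by rewrite expRD.
have -> : expR (- (r 0 - r N)) = E^-1 * q by rewrite opprB addrC expRD expRN.
have -> : expR (- (r 0 + r N)) = E^-1 * q' by rewrite opprD expRD expRN.
move=> H1 H2.
have iE : 0 < E^-1 by rewrite invr_gt0.
have H3 : E^-1 * (gm - gp) < e1 * (1 + E).
  have u1 : E^-1 * gm <= E^-1 * q * gm by rewrite -mulrA ler_pM2l // ler_peMl.
  have u2 : E^-1 * q' * gp <= E^-1 * gp by rewrite -mulrA ler_pM2l // ler_piMl.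
  have u3 : E * (q - q') <= E * e1 by rewrite ler_pM2l // ltW.
  by lra.
have H4 : c * (sp - sm) < e1 * (E * (1 + E)).
  apply: le_lt_trans gs _; rewrite mulrCA -ltr_pdivrMl //.
have : e1 * (E * (1 + E)) = e * c by rewrite divfK // gt_eqF // mulr_gt0 ?addr_gt0.
by move=> e1E; move: H4; rewrite e1E [e * c]mulrC ltr_pM2l.
Qed.

Lemma bc_shift_le t N i :
  mean N.+1 (bc t N.+1) (fun x => spin R (x i.+1)) <=
  mean N (bc t N) (fun x => spin R (x i)).
Proof.
apply: le_trans (mean_shift_le J_ge0 _ _ (increasing_spin (R := R) i)) _.
rewrite le_eqVlt; apply/orP; left; apply/eqP; apply: eq_mean => // k _.
by rewrite /bc subSS [r k]r_rec; ring.
Qed.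

Lemma bc_shiftn_le t N i k :
  mean (N + k) (bc t (N + k)) (fun x => spin R (x (i + k)%N)) <=
  mean N (bc t N) (fun x => spin R (x i)).
Proof.
elim: k => [|k IH]; first by rewrite !addn0.
by rewrite !addnS; apply: le_trans (bc_shift_le _ _ _) IH.
Qed.

Definition mag N i : R := mean N (right_plus N) (fun x => spin R (x i)).

(** If the last spin is made plus, it joins the plus half-line on the right. *)
Lemma mag_le N i : (i < N)%N -> mag N.+1 i <= mag N i.
Proof.
move=> iN; rewrite /mag.
apply: le_trans (mean_last_le J_ge0 _ _ (increasing_spin (R := R) i)) _.
  by move=> x x' ->.
rewrite le_eqVlt; apply/orP; left; apply/eqP; apply: eq_mean => // k kN.
by rewrite /right_plus subSn // [r (N - k.+1)%N]r_rec subnSK // addrC.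
Qed.

Lemma mag_leW N M i : (i < N)%N -> (N <= M)%N -> mag M i <= mag N i.
Proof.
move=> iN; elim: M => [|M IH]; first by rewrite leqn0 => /eqP ->.
rewrite leq_eqVlt => /orP[/eqP -> //|]; rewrite ltnS => NM.
by apply: le_trans (IH NM); apply: mag_le; exact: leq_trans iN NM.
Qed.

(** New sites on the free left end raise the magnetization by Griffiths' inequality, at unchanged
    distance from the plus spins. *)
Lemma mag_shift N i k : mag N i <= mag (N + k) (i + k).
Proof.
elim: k => [|k IH]; first by rewrite !addn0.
rewrite !addnS; apply: le_trans IH _; rewrite /mag.
have h0 i' : (i' < (N + k).+1)%N -> 0 <= right_plus (N + k).+1 i' by move=> _; exact: r_ge0.
apply: le_trans (mean_add_site J_ge0 h0 (pos_spin (i + k)%N)).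
by rewrite le_eqVlt; apply/orP; left; apply/eqP; apply: eq_mean => // l _;
  by rewrite /right_plus subSS.
Qed.

Lemma mag_ge0 N i : 0 <= mag N i.
Proof. by apply: mean_pos_ge0 => [//|*|]; [exact: r_ge0|exact: pos_spin]. Qed.

Lemma mag_le_bc N i : mag N i <= mean N (bc 1 N) (fun x => spin R (x i)).
Proof.
apply: mean_mono => //; last exact: increasing_spin.
by move=> k _; rewrite /bc /right_plus mul1r lerDr r_ge0.
Qed.

(** The bound [2 * d] is moved from [i0] to a far site [j] with [J j.+1 > 0], where plus-plus and
    plus-minus means can be brought within [d]. Cutting off sites on the left then brings [j] back
    to [i]; the sites removed become part of the plus half-line, which only raises the mean. *)
Lemma bc_minus_ge i0 (d : R) : 0 < d ->
  (forall n, exists2 j, (n <= j)%N & 0 < J j.+1) ->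
  (forall N, (i0 < N)%N -> 2 * d <= mag N i0) ->
  forall i, exists2 M, (i < M)%N & d <= mean M (bc (-1) M) (fun x => spin R (x i)).
Proof.
move=> d0 Jinf Hd i.
have [j ij Jj] := Jinf (maxn i i0); rewrite geq_max in ij.
have [ij' i0j] := andP ij.
have [N [_ jN close]] := spin_bc_close 0 Jj d0.
exists (N - (j - i))%N; first by lia.
apply: le_trans (bc_shiftn_le _ _ _ (j - i)).
have -> : (N - (j - i) + (j - i) = N)%N by lia.
have -> : (i + (j - i) = j)%N by lia.
have : 2 * d <= mean N (bc 1 N) (fun x => spin R (x j)).
  apply: le_trans (mag_le_bc N j).
  have /Hd H : (i0 < N - (j - i0))%N by lia.
  apply: le_trans H _.
  apply: le_trans (mag_shift _ _ (j - i0)) _.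
  have -> : (N - (j - i0) + (j - i0) = N)%N by lia.
  by have -> : (i0 + (j - i0) = j)%N by lia.
lra.
Qed.

End PlusLeft.

Arguments bc {R} r t N i.
Arguments right_plus {R} r N i.
Arguments mag {R} J r N i.

(** * Free blocks *)

Section FreeBlock.
Context {R : realType} {J r : nat -> R}.
Hypothesis J_ge0 : forall k, 0 <= J k.
Hypothesis r_ge0 : forall k, 0 <= r k.
Implicit Types (F G : (nat -> bool) -> R) (x y : nat -> bool) (N : nat).
Implicit Types (v h : nat -> R) (A C : R).

Local Notation mean := (mean (J := J)).

Lemma lin_shift N h x : lin N.+1 h x =
  h 0%N * spin R (x 0%N) + lin N (fun i => h i.+1) (fun i => x i.+1).
Proof. by rewrite /lin big_ord_recl. Qed.

Lemma prefix_lin_le n N h : (n <= N)%N -> prefix_fun N (lin (R := R) n h).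
Proof. by move=> nN; exact: prefix_funW nN (prefix_lin h). Qed.

(* With [v = fld ^~ x] this is the [N]-th iterate of the function 1 under the
   transfer operator at [x], divided by the free partition function. *)
Definition free_exp v N :=
  mean N (fun=> 0) (fun x => expR (lin N (fun i => v (N - i.+1)%N) x)).

(** For each sign, [K r] plus or minus [K v] lies in the cone. Its mean grows when a free site is
    coupled to the block, by Griffiths' second inequality; the field on that site adds the mean of
    another member of the cone, nonnegative by the first inequality. *)
Lemma free_exp_maj v N : (forall i, `|v i| <= r i) ->
  `|free_exp v N.+1 - free_exp v N| <= free_exp r N.+1 - free_exp r N.
Proof.
move=> vr; pose K (u : nat -> R) x : R := expR (lin N (fun i => u (N - i.+1)%N) x).
pose e (u : nat -> R) x : R := expR (u N * spin R (x 0%N)) - 1.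
have E u : free_exp u N.+1 = mean N.+1 (fun=> 0) (fun x =>
    e u x * K u (fun i => x i.+1) + K u (fun i => x i.+1)).
  apply: eq_mean => // x; rewrite lin_shift subSS subn0 expRD /e mulrBl mul1r.
  by rewrite subrK; congr (_ * expR _); apply: eq_lin => // i _; rewrite subSS.
have majK : maj (K r) (K v) by apply: maj_expR_sum => i _; exact: vr.
have majKs : maj (fun x => K r (fun i => x i.+1)) (fun x => K v (fun i => x i.+1)).
  by case: majK => p m; split; [exact: (pos_comp_shift p)|exact: (pos_comp_shift m)].
have maje : maj (fun x => e r x * K r (fun i => x i.+1))
                (fun x => e v x * K v (fun i => x i.+1)).
  by apply: majM majKs; exact: maj_expR_spin_sub1.
have z0 n i : (i < n)%N -> 0 <= (fun=> 0 : R) i by [].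
have H s : s = 1 \/ s = -1 -> free_exp r N + s * free_exp v N <=
    free_exp r N.+1 + s * free_exp v N.+1.
  move=> s1; have sP F G : maj F G -> pos_char (fun x => F x + s * G x).
    move=> [p m]; case: s1 => ->.
      by apply: eq_pos p => x; rewrite mul1r.
    by apply: eq_pos m => x; rewrite mulN1r.
  rewrite !E -!meanZ -!meanD.
  apply: le_trans (mean_add_site J_ge0 (z0 N.+1) (sP _ _ majK)) _.
  rewrite -subr_ge0 -meanB.
  apply: le_trans (mean_pos_ge0 J_ge0 (z0 N.+1) (sP _ _ maje)) _.
  by rewrite le_eqVlt; apply/orP; left; apply/eqP; apply: eq_mean => // x; ring.
have := H 1 (or_introl erefl); have := H (-1) (or_intror erefl).
by move=> h1 h2; apply/ler_normlP; split; lra.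
Qed.

Lemma mean0_flip N F : prefix_fun N F ->
  mean N (fun=> 0) (F \o spin_flip) = mean N (fun=> 0) F.
Proof. by move=> dF; rewrite mean_flip //; apply: eq_mean => // i _; rewrite oppr0. Qed.

Lemma lin_flip N h x : lin N h (spin_flip x) = - lin N h x :> R.
Proof. by rewrite /lin -sumrN; apply: eq_bigr => i _; rewrite spinN mulrN. Qed.

Lemma mean0_ge1 N F : prefix_fun N F -> (forall x, 2 <= F x + F (spin_flip x)) ->
  1 <= mean N (fun=> 0) F.
Proof.
move=> dF F2; have : 2 <= mean N (fun=> 0) F + mean N (fun=> 0) F.
  rewrite -{2}mean0_flip // -meanD -[leLHS](mean_cst (J := J) N (fun=> 0)).
  exact: le_mean.
lra.
Qed.

Lemma expR_sym_ge2 (c : R) : 2 <= expR c + expR (- c).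
Proof. by have := coshR_ge1 c; rewrite /coshR; lra. Qed.

Lemma free_exp_ge1 v N : 1 <= free_exp v N.
Proof.
apply: mean0_ge1 => [x x' xx|x]; first by congr expR; exact: prefix_lin.
by rewrite lin_flip expR_sym_ge2.
Qed.

Lemma mean_add_sites n k F : pos_char F ->
  mean n (fun=> 0) F <= mean (n + k) (fun=> 0) (fun x => F (fun i => x (i + k)%N)).
Proof.
move=> pF; elim: k => [|k IH].
  rewrite addn0 le_eqVlt; apply/orP; left; apply/eqP; apply: eq_mean => // x.
  by congr F; apply/funext => i; rewrite addn0.
have pFk : pos_char (fun x => F (fun i => x (i + k)%N)).
  elim: k {IH} => [|k IH].
    by apply: eq_pos pF => x; congr F; apply/funext => i; rewrite addn0.
  apply: eq_pos (pos_comp_shift IH) => x; congr F.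
  by apply/funext => i; rewrite addnS.
have z0 n' i : (i < n')%N -> 0 <= (fun=> 0 : R) i by [].
apply: le_trans IH _; rewrite addnS.
apply: le_trans (mean_add_site J_ge0 (z0 (n + k).+1) pFk) _.
rewrite le_eqVlt; apply/orP; left; apply/eqP; apply: eq_mean => // x.
by congr F; apply/funext => i; rewrite addnS.
Qed.

(** Free sites added on the left of the block raise the mean; reflection then carries the block to
    the left end, where the weights appear in the order they have in [r_fun]. *)
Lemma free_exp_le_left n N : (n <= N)%N ->
  free_exp r n <= mean N (fun=> 0) (fun x => expR (lin n r x)).
Proof.
move=> nN; pose G x := expR (lin n r x).
have dG : prefix_fun N G.
  by move=> x x' xx; congr expR; exact: (prefix_lin_le r nN).
have pK : pos_char (fun x => expR (lin n (fun i => r (n - i.+1)%N) x)).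
  apply: pos_expR.
  by apply: (@ferro_sum _ n (fun i x => r (n - i.+1)%N * spin R (x i))) => i _;
    exact: ferro_spin.
apply: le_trans (mean_add_sites n (N - n) pK) _.
rewrite subnKC //.
have <- : mean N (fun=> 0) (G \o rev_prefix N) = mean N (fun=> 0) G by rewrite mean_rev.
rewrite le_eqVlt; apply/orP; left; apply/eqP; apply: eq_mean => // x.
congr expR; rewrite /lin (reindex_inj rev_ord_inj); apply: eq_bigr => i _ /=.
have iN := ltn_ord i.
have -> : (n - (n - i.+1).+1 = i)%N by lia.
by rewrite /rev_prefix (leq_trans iN nN); congr (_ * spin R (x _)); lia.
Qed.

(** FKG separates the first [n] sites from the increasing factor [g] of the later ones, whose mean
    is at least 1 by flip symmetry. The bound [2 <= A] keeps min(e^c, A) + min(e^-c, A) at least 2.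
    The truncation permits the limit in [P] under the measure. *)
Lemma free_exp_le_trunc n P N A : (n <= P)%N -> (P <= N)%N -> 2 <= A ->
  free_exp r n <= mean N (fun=> 0)
    (fun x => Num.min (expR (lin P r x)) (A * expR (lin n r x))).
Proof.
move=> nP PN A2; have nN := leq_trans nP PN.
pose g x := Num.min (expR (lin P r x - lin n r x)) A.
have E x : Num.min (expR (lin P r x)) (A * expR (lin n r x)) =
    expR (lin n r x) * g x.
  rewrite /g minr_pMr ?expR_ge0 // -expRD addrC subrK.
  by rewrite [A * _]mulrC.
have -> : mean N (fun=> 0) (fun x => Num.min (expR (lin P r x)) (A * expR (lin n r x)))
    = mean N (fun=> 0) (fun x => expR (lin n r x) * g x) by apply: eq_mean.
have [k kP] : exists k, (P = n + k)%N by exists (P - n)%N; rewrite subnKC.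
have dE x : lin P r x - lin n r x = \sum_(i < k) r (n + i)%N * spin R (x (n + i)%N).
  by rewrite kP /lin big_split_ord /= addrAC subrr add0r.
have ig : increasing_cfg g.
  move=> x x' xx; rewrite /g le_min !ge_min ler_expR lexx orbT andbT !dE.
  by apply/orP; left; apply: ler_sum => i _; rewrite ler_wpM2l // le_spin.
have g1 : 1 <= mean N (fun=> 0) g.
  apply: mean0_ge1 => [x x' xx|x].
    by rewrite /g (prefix_lin_le r PN xx) (prefix_lin_le r nN xx).
  rewrite /g !lin_flip -opprD; set c := _ - _; have := expR_sym_ge2 c.
  have := expR_gt0 c; have := expR_gt0 (- c).
  by case: (leP (expR c) A); case: (leP (expR (- c)) A); lra.
apply: le_trans (mean_fkg J_ge0 _ _ _ ig); last first.
  by apply/increasing_expR/increasing_lin.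
rewrite -[leLHS]mulr1; apply: ler_pM => //; last exact: free_exp_le_left.
by apply: le_trans (free_exp_ge1 r n).
Qed.

(* If the magnetization with plus spins on the right vanishes, the state near the
   left end does not depend on the spins on the right: adding a large multiple of
   the total spin makes any function increasing. *)
Lemma mean_near_free l N h F C : (l <= N)%N -> prefix_fun l F ->
  (forall x, `|F x| <= C) -> (forall i, (i < N)%N -> `|h i| <= right_plus r N i) ->
  `|mean N h F - mean N (fun=> 0) F| <=
    4 * C * \sum_(i < l) mag J r N i.
Proof.
move=> lN dF FC hr.
have C0 : 0 <= C by apply: le_trans (FC all_plus); rewrite normr_ge0.
pose S x : R := \sum_(i < l) spin R (x i).
(* Raising some of the first [l] spins increases [S] by at least 2, while [F] varies by at most
   [2 * C]. *)
have incS s : s = 1 \/ s = -1 -> increasing_cfg (fun x => C * S x + s * F x).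
  move=> s1 x x' xx.
  have sF : `|s * F x| <= C /\ `|s * F x'| <= C.
    by case: s1 => ->; rewrite ?mul1r ?mulN1r ?normrN; split.
  have [/existsP[i xi]|/existsPn xi] := boolP [exists i : 'I_l, x i != x' i].
    have : S x + 2 <= S x'.
      rewrite /S (bigD1 i) //= [leRHS](bigD1 i) //= addrAC; apply: lerD.
        move: (xx i) xi; case: (x i); case: (x' i) => //= _ _; rewrite /spin; lra.
      by apply: ler_sum => k _; exact: le_spin.
    case: sF => /ler_normlP[a b] /ler_normlP[c d] SS.
    by have := ler_wpM2l C0 SS; lra.
  have xx' k : (k < l)%N -> x k = x' k.
    by move=> kl; have /negPn/eqP := xi (Ordinal kl).
  rewrite (dF _ _ xx') lerD2r; apply: ler_wpM2l => //.
  by apply: ler_sum => k _; exact: le_spin.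
pose a := mean N (right_plus r N) S.
have aE : a = \sum_(i < l) mag J r N i.
  exact: (mean_sum _ _ _ (fun i x => spin R (x i))).
have dS : prefix_fun l S.
  by move=> x x' xx; apply: eq_bigr => i _; rewrite xx.
have iS : increasing_cfg S.
  by move=> x x' xx; apply: ler_sum => k _; exact: le_spin.
(* By monotonicity the mean of [F] changes by at most [C] times that of [S], which lies between
   [- a] and [a] by spin flip. Applying this to [h] and to zero fields gives the factor 4. *)
have bound k : (forall i, (i < N)%N -> `|k i| <= right_plus r N i) ->
    `|mean N k F - mean N (right_plus r N) F| <= 2 * (C * a).
  move=> kr.
  have k_le i : (i < N)%N -> k i <= right_plus r N i.
    by move=> /kr; apply: le_trans; rewrite ler_norm.
  have k_ge i : (i < N)%N -> - right_plus r N i <= k i.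
    by move=> /kr /ler_normlP[]; lra.
  have Sge : - a <= mean N k S.
    apply: le_trans (mean_mono J_ge0 k_ge iS).
    rewrite -(mean_flip (right_plus r N) (prefix_funW lN dS)).
    rewrite -meanN le_eqVlt; apply/orP; left; apply/eqP; apply: eq_mean => // x.
    by rewrite /S -sumrN; apply: eq_bigr => i _; rewrite spinN.
  have := mean_mono J_ge0 k_le (incS 1 (or_introl erefl)).
  have := mean_mono J_ge0 k_le (incS (-1) (or_intror erefl)).
  rewrite !meanD !meanZ -/a => h1 h2; have := ler_wpM2l C0 Sge => h3.
  by apply/ler_normlP; split; lra.
have z0 i : (i < N)%N -> `|(fun=> 0 : R) i| <= right_plus r N i.
  by move=> _; rewrite normr0 r_ge0.
have := bound _ hr; have := bound _ z0; rewrite -aE.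
move=> /ler_normlP[b1 b2] /ler_normlP[b3 b4].
by apply/ler_normlP; split; lra.
Qed.

End FreeBlock.

(** * The transfer operator *)

Section UniformLimit.
Context {R : realType} {T : topologicalType}.

(** The scalar sequence [w] encodes a uniform Cauchy condition. This yields the fields of
    half-lines, the eigenfunction and the resolvent. *)
Lemma uniform_limit (f : nat -> T -> R) (w : nat -> R) : cvgn w ->
  (forall n m x, (n <= m)%N -> `|f m x - f n x| <= `|w m - w n|) ->
  (forall n, continuous (f n)) ->
  exists2 g : T -> R, continuous g & forall x, f n x @[n --> \oo] --> g x.
Proof.
move=> cw fw fc.
have wC (e : R) : 0 < e ->
    exists N, forall m n, (N <= m)%N -> (N <= n)%N -> `|w m - w n| < e.
  move=> e0; have e20 : 0 < e / 2 by rewrite divr_gt0.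
  have /cvgrPdist_lt /(_ _ e20)[N _ HN] := cw.
  exists N => m n /HN /= h1 /HN /= h2.
  apply: le_lt_trans (ler_distD (limn w) _ _) _.
  by rewrite [e]splitr ltrD // distrC.
have fC x : cvgn (f^~ x).
  apply/cauchy_cvgP/cauchy_exP => e e0.
  have [N HN] := wC _ e0; exists (f N x), N => // n Nn.
  rewrite /ball /= distrC; apply: le_lt_trans (fw _ _ _ Nn) _.
  exact: HN.
exists (fun x => limn (f^~ x)) => [x|x]; last exact: fC.
have close (e : R) : 0 < e -> exists N, forall y, `|limn (f^~ y) - f N y| <= e.
  move=> e0; have [N HN] := wC _ e0; exists N => y.
  have cN : `|f n y - f N y| @[n --> \oo] --> `|limn (f^~ y) - f N y|.
    by apply: cvg_norm; apply: cvgB; [exact: fC|exact: cvg_cst].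
  rewrite -(cvg_lim (@Rhausdorff R) cN); apply: limr_le; first exact: cvgP cN.
  exists N => // n Nn /=; apply: le_trans (fw _ _ _ Nn) _.
  by apply/ltW/HN.
apply/cvgrPdist_lt => e e0; have e30 : 0 < e / 3 by rewrite divr_gt0.
have [N HN] := close _ e30.
have /cvgrPdist_lt /(_ _ e30) := fc N x.
apply: filterS => y fy; have h1 := HN x; have h2 := HN y.
apply: le_lt_trans (ler_distD (f N x) _ _) _.
have h3 := ler_distD (f N y) (f N x) (limn (f^~ y)); rewrite distrC in h2.
lra.
Qed.

End UniformLimit.

Section Configurations.
Context {R : realType}.

Lemma continuous_spin i : continuous (fun x : cantor_space => spin R (x i)).
Proof.
move=> x; apply: (@continuous_comp _ _ _ (fun x : cantor_space => x i) (spin R)).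
  exact: (@proj_continuous _ (fun=> bool) i).
move=> A /nbhs_singleton sA; rewrite nbhs_principalE.
by apply/principal_filterP.
Qed.

Lemma continuous_scons a : continuous (scons a : cantor_space -> cantor_space).
Proof.
move=> x; apply/pointwise_cvgP => -[|i].
  by change ((fun=> a) @ nbhs x --> a); exact: cvg_cst.
exact: (@proj_continuous _ (fun=> bool) i).
Qed.

Lemma continuous_lin N h : continuous (lin N h : cantor_space -> R).
Proof.
elim: N => [|N IH].
  rewrite (_ : lin 0 h = fun=> 0); first by move=> x; exact: cvg_cst.
  by apply/funext => x; rewrite /lin big_ord0.
rewrite (_ : lin N.+1 h = fun x => lin N h x + h N * spin R (x N)).
  move=> x; apply: cvgD; first exact: IH.
  by apply: cvgM; [exact: cvg_cst|exact: continuous_spin].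
by apply/funext => x; rewrite /lin big_ord_recr.
Qed.

End Configurations.

(** * Tails of the interaction, fields of half-lines and iterates of the operator *)

Section Potential.
Context {R : realType} {J : nat -> R}.
Hypothesis J_ge0 : forall k, 0 <= J k.
Hypothesis J_sum : cvgn (series J).

Local Notation r := (tail_sum J).

Lemma tail_sumE n : r n = limn (series J) - series J n.+1.
Proof.
apply/(cvg_lim (@Rhausdorff R)).
have : series J m - series J n.+1 @[m --> \oo] --> limn (series J) - series J n.+1.
  by apply: cvgB => //; exact: cvg_cst.
apply: cvg_trans; apply: near_eq_cvg; exists n.+1 => // m /= nm.
by rewrite sub_series_geq.
Qed.

Lemma tail_sum_ge0 n : 0 <= r n.
Proof.
rewrite tail_sumE subr_ge0; apply: nondecreasing_cvgn_le => //.
by apply/nondecreasing_seqP => k; rewrite seriesS addrC lerDl.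
Qed.

Lemma tail_sum_rec n : r n = J n.+1 + r n.+1.
Proof. by rewrite !tail_sumE [series J n.+2]seriesS; ring. Qed.

Lemma tail_sum_cvg0 : r @ \oo --> (0 : R).
Proof.
have H : series J n.+1 @[n --> \oo] --> limn (series J).
  by rewrite (cvg_shiftS (series J)).
have H0 : limn (series J) - series J n.+1 @[n --> \oo] --> (0 : R).
  rewrite -[X in _ --> X](subrr (limn (series J))).
  exact: cvgB (cvg_cst _) H.
by apply: cvg_trans H0; apply: near_eq_cvg; near=> n; rewrite tail_sumE.
Unshelve. all: by end_near. Qed.

Definition fld_part (i n : nat) (x : nat -> bool) : R :=
  \sum_(k < n) J (i + k).+1 * spin R (x k).

Lemma fld_partS i n x :
  fld_part i n.+1 x = fld_part i n x + J (i + n).+1 * spin R (x n).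
Proof. by rewrite /fld_part big_ord_recr. Qed.

Lemma fld_part_dist i x n m : (n <= m)%N ->
  `|fld_part i m x - fld_part i n x| <= `|r (i + m)%N - r (i + n)%N|.
Proof.
move=> nm; have -> : `|r (i + m)%N - r (i + n)%N| = r (i + n)%N - r (i + m)%N.
  rewrite ler0_norm ?opprB // subr_le0.
  by apply: (r_le J_ge0 tail_sum_rec); rewrite leq_add2l.
elim: m nm => [|m IH]; first by rewrite leqn0 => /eqP ->; rewrite !subrr normr0.
rewrite leq_eqVlt => /orP[/eqP ->|]; first by rewrite !subrr normr0.
rewrite ltnS => /IH {}IH.
rewrite fld_partS addrAC addnS.
apply: le_trans (ler_normD _ _) _; rewrite normrM spin_norm mulr1.
by rewrite ger0_norm //; have := tail_sum_rec (i + m); lra.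
Qed.

(* The field which the configuration [x] creates on a site that is separated from
   it by [i] sites. *)
Definition fld (i : nat) (x : nat -> bool) : R := limn (fld_part i ^~ x).

Let fld_lim i : exists2 g : cantor_space -> R, continuous g &
  forall x, fld_part i n x @[n --> \oo] --> g x.
Proof.
apply: (@uniform_limit R cantor_space (fld_part i) (fun n => r (i + n)%N)).
- apply: (cvgP (0 : R)); rewrite (_ : (fun n => _) = [sequence r (n + i)%N]_n).
    by rewrite cvg_shiftn; exact: tail_sum_cvg0.
  by apply/funext => n; rewrite addnC.
- by move=> n m x; exact: fld_part_dist.
- by move=> n; exact: (@continuous_lin R n (fun k => J (i + k).+1)).
Qed.

Lemma fld_cvg i x : fld_part i n x @[n --> \oo] --> fld i x.
Proof. by have [g _ gl] := fld_lim i; apply: cvgP (gl x). Qed.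

Lemma continuous_fld i : continuous (fld i : cantor_space -> R).
Proof.
have [g cg gl] := fld_lim i; rewrite (_ : fld i = g) //.
by apply/funext => x; apply/(cvg_lim (@Rhausdorff R)).
Qed.

Lemma fld_scons i a x : fld i (scons a x) = J i.+1 * spin R a + fld i.+1 x.
Proof.
apply/(cvg_lim (@Rhausdorff R)); rewrite -cvg_shiftS /=.
rewrite (_ : (fun n => _) = fun n => J i.+1 * spin R a + fld_part i.+1 n x).
  by apply: cvgD; [exact: cvg_cst|exact: fld_cvg].
apply/funext => n; rewrite /fld_part big_ord_recl addn0; congr (_ + _).
by apply: eq_bigr => k _; rewrite addnS.
Qed.

Lemma fld_le i x : `|fld i x| <= r i.
Proof.
have cN : `|fld_part i n x| @[n --> \oo] --> `|fld i x|.
  by apply: cvg_norm; exact: fld_cvg.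
rewrite -(cvg_lim (@Rhausdorff R) cN); apply: limr_le; first exact: cvgP cN.
near=> n; have := fld_part_dist i x (leq0n n).
rewrite {2}/fld_part big_ord0 subr0 => /le_trans; apply.
rewrite addn0 distrC ger0_norm ?subr_ge0.
  by rewrite lerBlDr lerDl tail_sum_ge0.
by apply: (r_le J_ge0 tail_sum_rec); rewrite ?addn0 leq_addr.
Unshelve. all: by end_near. Qed.

Lemma potentialE a x : potential J (scons a x) = spin R a * fld 0 x.
Proof.
rewrite /potential /=; congr (_ * _); apply/(cvg_lim (@Rhausdorff R)).
rewrite -cvg_shiftS /= (_ : (fun n => _) = fld_part 0 ^~ x); first exact: fld_cvg.
by apply/funext => n; rewrite big_add1 big_mkord.
Qed.

Lemma transferE f x : transfer (potential J) f x =
  expR (fld 0 x) * f (scons true x) + expR (- fld 0 x) * f (scons false x).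
Proof.
rewrite /transfer.
rewrite (_ : left_shift @^-1` [set x] =
    [set (scons true x : cantor_space)] `|` [set (scons false x : cantor_space)]).
  rewrite fsbigU0 //; last first.
    by move=> y [/= -> /(congr1 (fun z : nat -> bool => z 0%N))].
  by rewrite !fsbig_set1 !potentialE /spin mul1r mulN1r.
apply/seteqP; split => [y /= yx|y /= [] ->]; rewrite /left_shift //.
rewrite -(scons_shift y) -yx; case: (y 0%N); [by left|by right].
Qed.

Lemma continuous_transfer f : CX f -> CX (transfer (potential J) f).
Proof.
move=> cf; rewrite /CX /= (_ : transfer _ _ = fun x : cantor_space =>
    expR (fld 0 x) * f (scons true x) + expR (- fld 0 x) * f (scons false x)).
  have cfs a : continuous (f \o (scons a : cantor_space -> cantor_space)).
    by move=> x; apply: continuous_comp; [exact: continuous_scons|exact: cf].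
  move=> x; apply: cvgD; apply: cvgM; try exact: cfs.
    by apply: continuous_cvg; [exact: continuous_expR|exact: continuous_fld].
  by apply: continuous_cvg; [exact: continuous_expR|apply: cvgN; exact: continuous_fld].
by apply/funext => x; rewrite transferE.
Qed.

Lemma fld_prefix i N y :
  fld i y = fld_part i N y + fld (i + N) (fun k => y (N + k)%N).
Proof.
elim: N => [|N IH].
  by rewrite /fld_part big_ord0 add0r addn0; congr fld; apply/funext.
rewrite IH fld_partS -addrA addnS; congr (_ + _).
rewrite -[X in fld _ X]scons_shift fld_scons addn0; congr (_ + fld _ _).
by apply/funext => k; rewrite addSnnS.
Qed.

(* The iterated transfer operator sums over the states of a block whose right
   neighbours are prescribed. *)
Lemma iter_transferE N f x : iter N (transfer (potential J)) f x =
  psum N x (fun y => wgt J N (fun i => fld (N - i.+1) x) y * f y).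
Proof.
elim: N f => [|N IH] f.
  by rewrite /= /wgt /bond /lin !big_ord0 addr0 expR0 mul1r.
rewrite iterSr IH /= -psumD; apply: eq_psum_in => y yx.
(* The new spin meets its couplings to the block and the field of [x]; together these make up
   [fld 0 y]. *)
have E a : wgt J N.+1 (fun i => fld (N.+1 - i.+1) x) (scons a y) =
    wgt J N (fun i => fld (N - i.+1) x) y * expR (spin R a * fld 0 y).
  rewrite wgt_scons subSS subn0 (@wgtD _ _ N (fun i => fld (N - i.+1) x)).
  rewrite mulrCA -expRD; congr (_ * expR _).
  rewrite (fld_prefix 0 N y) add0n mulrDr addrC [fld N x * _]mulrC.
  congr (_ + _ * fld _ _); last by apply/funext => k; rewrite yx.
  by rewrite /lin /fld_part mulr_sumr; apply: eq_bigr => k _; rewrite mulrA.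
by rewrite transferE /comp !E /spin mul1r mulN1r; ring.
Qed.

Lemma iter_transfer_prefixE N f x : prefix_fun N f ->
  iter N (transfer (potential J)) f x =
  Zsum (J := J) N (fun i => fld (N - i.+1) x) f.
Proof.
move=> df; rewrite iter_transferE; apply: psum_base => y y' yy.
by rewrite (prefix_wgt _ _ yy) (df _ _ yy).
Qed.

Lemma continuous_iter_transfer N f :
  CX f -> CX (iter N (transfer (potential J)) f).
Proof. by elim: N => [//|N IH] cf; apply/continuous_transfer/IH. Qed.

End Potential.

(** * The eigenfunction *)

Section Eigenfunction.
Context {R : realType} {J : nat -> R}.
Hypothesis J_ge0 : forall k, 0 <= J k.
Hypothesis J_sum : cvgn (series J).

Local Notation L := (transfer (potential J)).
Local Notation r := (tail_sum J).
Local Notation fld := (fld (J := J)).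
Local Notation Z0 n := (Zsum (J := J) n (fun=> 0) (fun=> 1)).

Let FE n x : free_exp (J := J) (fld ^~ x) n = iter n L (fun=> 1) x / Z0 n.
Proof.
rewrite iter_transfer_prefixE //; congr (_ / _).
rewrite [RHS](eq_Zsum (h' := fun i => 0 + fld (n - i.+1) x) (F' := fun=> 1)) //.
  by rewrite (Zsum_tilt _ (fun=> 0)); apply: eq_Zsum => // y /=; rewrite mul1r.
by move=> i _; rewrite add0r.
Qed.

Lemma free_exp_eigenfunction C : (forall n, free_exp (J := J) r n <= C) ->
  exists (h : cantor_space -> R) (k : R),
    [/\ CX h, forall x, 1 <= h x, 0 < k & forall x, L h x = k * h x].
Proof.
move=> QC; pose Q n := free_exp (J := J) r n; pose F n x := free_exp (J := J) (fld ^~ x) n.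
have FS n x : `|F n.+1 x - F n x| <= Q n.+1 - Q n.
  by apply: (free_exp_maj J_ge0 n) => i; exact: fld_le.
have Qnd : nondecreasing_seq Q.
  apply/nondecreasing_seqP => n; rewrite -subr_ge0.
  exact: le_trans (normr_ge0 _) (FS n all_plus).
have Qcvg : cvgn Q.
  by apply: nondecreasing_is_cvgn => //; exists C => _ [n _ <-]; exact: QC.
have FQ n m x : (n <= m)%N -> `|F m x - F n x| <= `|Q m - Q n|.
  move=> nm; rewrite [leRHS]ger0_norm ?subr_ge0 ?Qnd //.
  elim: m nm => [|m IH]; first by rewrite leqn0 => /eqP ->; rewrite !subrr normr0.
  rewrite leq_eqVlt => /orP[/eqP ->|]; first by rewrite !subrr normr0.
  rewrite ltnS => /IH {}IH; have := FS m x; have := ler_distD (F m x) (F m.+1 x) (F n x).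
  by lra.
have Fc n : continuous (F n : cantor_space -> R).
  rewrite (_ : F n = fun x => iter n L (fun=> 1) x / Z0 n); last first.
    by apply/funext => x; exact: FE.
  move=> x; apply: cvgM; last exact: cvg_cst.
  by apply: (continuous_iter_transfer J_ge0 J_sum) => y; exact: cvg_cst.
have [g gc gl] := @uniform_limit R cantor_space F Q Qcvg FQ Fc.
have g1 x : 1 <= g x.
  rewrite -(cvg_lim (@Rhausdorff R) (gl x)); apply: limr_ge.
    exact: cvgP (gl x).
  by near=> n; exact: free_exp_ge1.
have g_gt0 x : 0 < g x by apply: lt_le_trans (g1 x).
pose k n := Z0 n.+1 / Z0 n.
have LF n x : L (F n) x = k n * F n.+1 x.
  have -> : F n = fun x => (Z0 n)^-1 * iter n L (fun=> 1) x.
    by apply/funext => y; rewrite mulrC; exact: FE.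
  have -> : L (fun x => (Z0 n)^-1 * iter n L (fun=> 1) x) x =
      (Z0 n)^-1 * iter n.+1 L (fun=> 1) x.
    by rewrite iterS !transferE //; ring.
  by rewrite /F FE /k; field; rewrite !Z_neq0.
have Lg x : L (F n) x @[n --> \oo] --> L g x.
  rewrite transferE // (_ : (fun n => _) = fun n =>
    expR (fld 0 x) * F n (scons true x) + expR (- fld 0 x) * F n (scons false x)).
    by apply: cvgD; apply: cvgM; try exact: gl; exact: cvg_cst.
  by apply/funext => n; rewrite transferE.
have gS x : F n.+1 x @[n --> \oo] --> g x by rewrite (cvg_shiftS (F^~ x)).
(* The scalars [k n] do not depend on [x], so neither does the limit [L g x / g x]: this makes [g]
   an eigenfunction. *)
have kl x : k n @[n --> \oo] --> L g x / g x.
  have H : L (F n) x / F n.+1 x @[n --> \oo] --> L g x / g x.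
    by apply: cvgM; [exact: Lg|apply: cvgV => //; rewrite gt_eqF].
  apply: cvg_trans H; apply: near_eq_cvg; near=> n.
  by rewrite LF mulfK // gt_eqF // (lt_le_trans ltr01) // free_exp_ge1.
exists g, (L g all_plus / g all_plus); split => //.
  rewrite divr_gt0 // transferE // addr_gt0 // mulr_gt0 ?expR_gt0 //.
move=> x; rewrite (cvg_unique _ (kl all_plus) (kl x)) ?divfK ?gt_eqF //.
Unshelve. all: by end_near. Qed.

End Eigenfunction.

(** * The spectral radius *)

Section SpectralRadius.
Context {R : realType}.

Definition cmod (a b : R) := Num.sqrt (a ^+ 2 + b ^+ 2).

Lemma cmod_ge0 a b : 0 <= cmod a b. Proof. exact: sqrtr_ge0. Qed.

Lemma cmod_sqr a b : cmod a b ^+ 2 = a ^+ 2 + b ^+ 2.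
Proof. by rewrite sqr_sqrtr // addr_ge0 ?sqr_ge0. Qed.

Lemma cmodM a b c d : cmod (a * c - b * d) (a * d + b * c) = cmod a b * cmod c d.
Proof.
rewrite -sqrtrM ?addr_ge0 ?sqr_ge0 //; congr Num.sqrt; ring.
Qed.

Lemma cmodD a b c d : cmod (a + c) (b + d) <= cmod a b + cmod c d.
Proof.
have s0 := cmod_ge0 a b; have t0 := cmod_ge0 c d.
rewrite -(ler_pXn2r (n := 2)) ?nnegrE ?addr_ge0 ?cmod_ge0 //.
rewrite sqrrD !cmod_sqr.
suff : a * c + b * d <= cmod a b * cmod c d by nra.
rewrite -sqrtrM ?addr_ge0 ?sqr_ge0 //.
apply: le_trans (ler_norm _) _; rewrite -sqrtr_sqr ler_wsqrtr //.
by rewrite -subr_ge0; have := sqr_ge0 (a * d - b * c); nra.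
Qed.

Lemma cmodZ w a b : 0 <= w -> cmod (w * a) (w * b) = w * cmod a b.
Proof.
move=> w0; have := cmodM w 0 a b; rewrite !mul0r subr0 addr0 => ->.
by rewrite /cmod expr0n addr0 sqrtr_sqr ger0_norm.
Qed.

Lemma normr_le_cmod a b : `|a| <= cmod a b /\ `|b| <= cmod a b.
Proof.
by rewrite -!sqrtr_sqr !ler_wsqrtr // ?lerDl ?lerDr sqr_ge0.
Qed.

End SpectralRadius.

(** * The resolvent beyond the eigenvalue of a positive eigenfunction *)

Section SpectralRadiusEigen.
Context {R : realType} {J : nat -> R}.
Hypothesis J_ge0 : forall k, 0 <= J k.
Hypothesis J_sum : cvgn (series J).

Local Notation L := (transfer (potential J)).
Local Notation fld := (fld (J := J)).

Lemma CX_bounded (f : cantor_space -> R) : CX f ->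
  exists2 M : R, 0 <= M & forall x, `|f x| <= M.
Proof.
move=> cf.
have cpt : compact (f @` [set: cantor_space]).
  apply: continuous_compact cantor_space_compact.
  exact: continuous_subspaceT.
have [M [Mr HM]] := compact_bounded cpt.
exists (`|M| + 1); first by rewrite addr_ge0.
move=> x; apply: HM; last by exists x.
by rewrite (le_lt_trans (ler_norm _)) // ltrDl.
Qed.

Variables (h : cantor_space -> R) (k : R).
Hypothesis ch : CX h.
Hypothesis h_ge1 : forall x, 1 <= h x.
Hypothesis k_gt0 : 0 < k.
Hypothesis Lh : forall x, L h x = k * h x.

(** By positivity the complexified operator has norm at most [k] for the sup norm weighted by 1/h.
    As [h] is at least 1, every bounded function has finite weighted norm. *)
Let Lcmod (f g : cantor_space -> R) c :
  (forall x, cmod (f x) (g x) <= c * h x) ->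
  forall x, cmod (L f x) (L g x) <= c * (k * h x).
Proof.
move=> fg x; rewrite -Lh !transferE // mulrDr.
apply: le_trans (cmodD _ _ _ _) _.
by apply: lerD; rewrite cmodZ ?expR_ge0 // mulrCA ler_wpM2l ?expR_ge0.
Qed.

Let LB (f g : cantor_space -> R) x : L (fun y => f y - g y) x = L f x - L g x.
Proof. by rewrite !transferE //; ring. Qed.

Let h_gt0 x : 0 < h x. Proof. exact: lt_le_trans (h_ge1 x). Qed.

Section Resolvent.
Variables a b : R.
Hypothesis kz : k < cmod a b.

Let m := a ^+ 2 + b ^+ 2.
Let q := k / cmod a b.

Let z_gt0 : 0 < cmod a b. Proof. exact: lt_trans kz. Qed.
Let m_gt0 : 0 < m. Proof. by rewrite /m -cmod_sqr exprn_gt0. Qed.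
Let q_ge0 : 0 <= q. Proof. by rewrite divr_ge0 ?ltW. Qed.
Let q_lt1 : q < 1. Proof. by rewrite ltr_pdivrMr // mul1r. Qed.

(** The difference of two solutions satisfies z d = L d, so each bound [c * h] on its modulus
    improves to [c * q * h] with [q < 1]. *)
Let shift_inj : set_inj (@CX R `*` @CX R) (complex_shift L (a, b)).
Proof.
move=> [f1 f2] [g1 g2]; rewrite !inE /= => -[/CX_bounded[M1 _ HM1] /CX_bounded[M2 _ HM2]].
move=> [/CX_bounded[M3 _ HM3] /CX_bounded[M4 _ HM4]] [E1 E2].
pose d1 x := f1 x - g1 x; pose d2 x := f2 x - g2 x.
have e1 x : a * d1 x - b * d2 x = L d1 x.
  have /(congr1 (fun F : cantor_space -> R => F x)) /= := E1.
  by rewrite /d1 /d2 LB; lra.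
have e2 x : a * d2 x + b * d1 x = L d2 x.
  have /(congr1 (fun F : cantor_space -> R => F x)) /= := E2.
  by rewrite /d1 /d2 LB; lra.
have step c : (forall x, cmod (d1 x) (d2 x) <= c * h x) ->
    forall x, cmod (d1 x) (d2 x) <= c * q * h x.
  move=> H x; have := Lcmod H x; rewrite -e1 -e2 cmodM.
  rewrite -ler_pdivlMl // => /le_trans; apply.
  by rewrite /q le_eqVlt; apply/orP; left; apply/eqP; ring.
have [c [c0 H]] : exists c, 0 <= c /\ forall x, cmod (d1 x) (d2 x) <= c * h x.
  exists (M1 + M3 + (M2 + M4)); split.
    have := le_trans (normr_ge0 _) (HM1 all_plus); have := le_trans (normr_ge0 _) (HM2 all_plus).
    have := le_trans (normr_ge0 _) (HM3 all_plus); have := le_trans (normr_ge0 _) (HM4 all_plus).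
    lra.
  move=> x; apply: le_trans (_ : M1 + M3 + (M2 + M4) <= _).
    have := cmodD (d1 x) 0 0 (d2 x); rewrite addr0 add0r.
    have -> : cmod (d1 x) 0 = `|d1 x| by rewrite /cmod expr0n addr0 sqrtr_sqr.
    have -> : cmod 0 (d2 x) = `|d2 x| by rewrite /cmod expr0n add0r sqrtr_sqr.
    move/le_trans; apply; apply: lerD.
      by apply: le_trans (ler_normB _ _) _; exact: lerD.
    by apply: le_trans (ler_normB _ _) _; exact: lerD.
  rewrite ler_peMr //.
  have := le_trans (normr_ge0 _) (HM1 all_plus); have := le_trans (normr_ge0 _) (HM2 all_plus).
  have := le_trans (normr_ge0 _) (HM3 all_plus); have := le_trans (normr_ge0 _) (HM4 all_plus).
  lra.
have Hn n x : cmod (d1 x) (d2 x) <= c * q ^+ n * h x.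
  elim: n x => [|n IH] x; first by rewrite expr0 mulr1.
  by rewrite exprSr mulrA; exact: step.
have d0 x : cmod (d1 x) (d2 x) = 0.
  apply/eqP; rewrite eq_le cmod_ge0 andbT.
  have cv : c * q ^+ n * h x @[n --> \oo] --> (0 : R).
    rewrite [X in _ --> X](_ : 0 = c * 0 * h x); last by rewrite mulr0 mul0r.
    apply: cvgM; last exact: cvg_cst.
    apply: cvgM; first exact: cvg_cst.
    by apply: cvg_expr; rewrite ger0_norm.
  rewrite -(cvg_lim (@Rhausdorff R) cv); apply: limr_ge; first exact: cvgP cv.
  by near=> n; exact: Hn.
have [z1 z2] : (forall x, d1 x = 0) /\ (forall x, d2 x = 0).
  by split => x; apply/eqP; rewrite -normr_le0 -(d0 x); have [] := normr_le_cmod (d1 x) (d2 x).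
by congr pair; apply/funext => x; apply/eqP; rewrite -subr_eq0; apply/eqP; [exact: z1|exact: z2].
Unshelve. all: by end_near. Qed.

(** Neumann iteration of F -> (g + L F)/z from 0, where 1/z is (a - ib)/m. The increments decay like
    [q ^+ n]. *)
Let shift_surj : set_surj (@CX R `*` @CX R) (@CX R `*` @CX R) (complex_shift L (a, b)).
Proof.
move=> [g1 g2] /= [cg1 cg2].
pose step (F : (cantor_space -> R) * (cantor_space -> R)) :=
  (fun x => (a * (g1 x + L F.1 x) + b * (g2 x + L F.2 x)) / m,
   fun x => (a * (g2 x + L F.2 x) - b * (g1 x + L F.1 x)) / m).
pose F n := iter n step (fun=> 0, fun=> 0).
have Fc n : CX (F n).1 /\ CX (F n).2.
  elim: n => [|n [IH1 IH2]]; first by split => x; exact: cvg_cst.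
  have c1 : continuous (fun x => g1 x + L (F n).1 x).
    by move=> x; apply: cvgD; [exact: cg1|exact: (continuous_transfer J_ge0 J_sum IH1)].
  have c2 : continuous (fun x => g2 x + L (F n).2 x).
    by move=> x; apply: cvgD; [exact: cg2|exact: (continuous_transfer J_ge0 J_sum IH2)].
  split => x /=; (apply: cvgM; last exact: cvg_cst).
    by apply: cvgD; apply: cvgM; try exact: cvg_cst; [exact: c1|exact: c2].
  by apply: cvgB; apply: cvgM; try exact: cvg_cst; [exact: c2|exact: c1].
pose d n x := cmod ((F n.+1).1 x - (F n).1 x) ((F n.+1).2 x - (F n).2 x).
have inv u v : cmod ((a * u + b * v) / m) ((a * v - b * u) / m) = cmod u v / cmod a b.
  have -> : (a * u + b * v) / m = a / m * u - (- b / m) * v by field; rewrite gt_eqF.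
  have -> : (a * v - b * u) / m = a / m * v + (- b / m) * u by field; rewrite gt_eqF.
  rewrite cmodM mulrC; congr (_ * _).
  rewrite ![_ / m]mulrC cmodZ ?invr_ge0 ?ltW //.
  have -> : cmod a (- b) = cmod a b by rewrite /cmod sqrrN.
  rewrite /m -cmod_sqr; field; rewrite gt_eqF //.
have dS n x : d n.+1 x =
    cmod (L (F n.+1).1 x - L (F n).1 x) (L (F n.+1).2 x - L (F n).2 x) / cmod a b.
  rewrite -inv /d /=; congr cmod; rewrite -mulrBl; congr (_ / _); ring.
have [c [c0 d0]] : exists c, 0 <= c /\ forall x, d 0%N x <= c * h x.
  have [M1 M10 HM1] := CX_bounded (Fc 1%N).1; have [M2 M20 HM2] := CX_bounded (Fc 1%N).2.
  exists (M1 + M2); split; first exact: addr_ge0.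
  move=> x; apply: (@le_trans _ _ (M1 + M2)); last by rewrite ler_peMr ?addr_ge0.
  have := cmodD ((F 1%N).1 x) 0 0 ((F 1%N).2 x); rewrite addr0 add0r /d !subr0.
  move/le_trans; apply; apply: lerD.
    by rewrite /cmod expr0n addr0 sqrtr_sqr.
  by rewrite /cmod expr0n add0r sqrtr_sqr.
have dn n x : d n x <= c * q ^+ n * h x.
  elim: n x => [|n IH] x; first by rewrite expr0 mulr1.
  rewrite dS -!LB ler_pdivrMr //.
  apply: le_trans (Lcmod IH x) _.
  rewrite exprSr /q le_eqVlt; apply/orP; left; apply/eqP; field; rewrite gt_eqF //.
have [H H0 HH] := CX_bounded ch.
(* The negated tail of the geometric series: [w] is nondecreasing with increments [c * H * q ^+ n],
   the form that [uniform_limit] asks for. *)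
pose w n := - (c * H * q ^+ n / (1 - q)).
have q10 : 0 < 1 - q by rewrite subr_gt0.
have wS n : w n.+1 - w n = c * H * q ^+ n.
  by rewrite /w exprS; field; rewrite gt_eqF.
have w_le n p : (n <= p)%N -> w n <= w p.
  elim: p => [|p IH]; first by rewrite leqn0 => /eqP ->.
  rewrite leq_eqVlt => /orP[/eqP -> //|]; rewrite ltnS => /IH /le_trans; apply.
  by rewrite -subr_ge0 wS !mulr_ge0 // exprn_ge0.
have wc : cvgn w.
  apply: (cvgP (- (c * H * 0 / (1 - q)))); apply: cvgN.
  apply: cvgM; last exact: cvg_cst.
  by apply: cvgM; [exact: cvg_cst|apply: cvg_expr; rewrite ger0_norm].
have dH n x : d n x <= w n.+1 - w n.
  apply: le_trans (dn n x) _; rewrite wS mulrAC ler_wpM2r ?exprn_ge0 //.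
  by rewrite ler_wpM2l // (le_trans (ler_norm _)).
have lim_comp (p : (cantor_space -> R) * (cantor_space -> R) -> (cantor_space -> R)) :
    (forall n x, `|p (F n.+1) x - p (F n) x| <= d n x) ->
    forall n p' x, (n <= p')%N -> `|p (F p') x - p (F n) x| <= `|w p' - w n|.
  move=> pd n p' x np; rewrite [leRHS]ger0_norm ?subr_ge0 ?w_le //.
  elim: p' np => [|p' IH]; first by rewrite leqn0 => /eqP ->; rewrite !subrr normr0.
  rewrite leq_eqVlt => /orP[/eqP ->|]; first by rewrite !subrr normr0.
  rewrite ltnS => /IH {}IH.
  have := le_trans (pd p' x) (dH p' x).
  by have := ler_distD (p (F p') x) (p (F p'.+1) x) (p (F n) x); lra.
have [f1 cf1 lf1] := @uniform_limit R cantor_space (fun n => (F n).1) w wc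
  (lim_comp fst (fun n x => (normr_le_cmod _ _).1)) (fun n => (Fc n).1).
have [f2 cf2 lf2] := @uniform_limit R cantor_space (fun n => (F n).2) w wc
  (lim_comp snd (fun n x => (normr_le_cmod _ _).2)) (fun n => (Fc n).2).
have Llim f (G : nat -> cantor_space -> R) x : (forall y, G n y @[n --> \oo] --> f y) ->
    L (G n) x @[n --> \oo] --> L f x.
  move=> Gf; rewrite transferE // (_ : (fun n => _) = fun n =>
    expR (fld 0 x) * G n (scons true x) + expR (- fld 0 x) * G n (scons false x)).
    by apply: cvgD; apply: cvgM; try exact: Gf; exact: cvg_cst.
  by apply/funext => n; rewrite transferE.
have fix1 x : f1 x = (a * (g1 x + L f1 x) + b * (g2 x + L f2 x)) / m.
  apply: (cvg_unique _ (_ : (F n.+1).1 x @[n --> \oo] --> f1 x)) => //.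
    by rewrite (cvg_shiftS (fun n => (F n).1 x)).
  apply: cvgM; last exact: cvg_cst.
  apply: cvgD; apply: cvgM; try exact: cvg_cst; apply: cvgD; try exact: cvg_cst.
    exact: (Llim f1 (fun n => (F n).1)).
  exact: (Llim f2 (fun n => (F n).2)).
have fix2 x : f2 x = (a * (g2 x + L f2 x) - b * (g1 x + L f1 x)) / m.
  apply: (cvg_unique _ (_ : (F n.+1).2 x @[n --> \oo] --> f2 x)) => //.
    by rewrite (cvg_shiftS (fun n => (F n).2 x)).
  apply: cvgM; last exact: cvg_cst.
  apply: cvgB; apply: cvgM; try exact: cvg_cst; apply: cvgD; try exact: cvg_cst.
    exact: (Llim f2 (fun n => (F n).2)).
  exact: (Llim f1 (fun n => (F n).1)).
exists (f1, f2); first by split.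
rewrite /complex_shift /=; congr pair; apply/funext => x.
  by rewrite {1}fix1 {1}fix2 /m; field; rewrite gt_eqF.
by rewrite {1}fix1 {1}fix2 /m; field; rewrite gt_eqF.
Qed.

Lemma complex_shift_bij : ~ spectrum L (a, b).
Proof.
apply; split; [|exact: shift_inj|exact: shift_surj].
move=> [f1 f2] /= [cf1 cf2].
have cL1 := continuous_transfer J_ge0 J_sum cf1.
have cL2 := continuous_transfer J_ge0 J_sum cf2.
split => x /=.
  apply: cvgB; last exact: cL1.
  by apply: cvgB; apply: cvgM; try exact: cvg_cst; [exact: cf1|exact: cf2].
apply: cvgB; last exact: cL2.
by apply: cvgD; apply: cvgM; try exact: cvg_cst; [exact: cf2|exact: cf1].
Qed.

End Resolvent.

(** The eigenfunction puts [k] into the spectrum, and no point of larger modulus belongs to it. *)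
Lemma spectral_radius_eigen : spectral_radius L = k.
Proof.
have kS : [set Num.sqrt (z.1 ^+ 2 + z.2 ^+ 2) | z in spectrum L] k.
  exists (k, 0); last by rewrite /= expr0n addr0 sqrtr_sqr ger0_norm // ltW.
  move=> [_ inj _].
  have c0 : CX (fun=> 0 : R) by move=> x; exact: cvg_cst.
  have : (h, (fun=> 0) : cantor_space -> R) = (fun=> 0, fun=> 0).
    apply: inj; rewrite ?inE //=; congr pair; apply/funext => x.
      by rewrite Lh !transferE //=; ring.
    by rewrite !transferE //=; ring.
  move=> /(congr1 fst) /(congr1 (fun F : cantor_space -> R => F all_plus)) /= h0.
  by have := h_gt0 all_plus; rewrite h0 ltxx.
have ubk : ubound [set Num.sqrt (z.1 ^+ 2 + z.2 ^+ 2) | z in spectrum L] k.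
  move=> _ [[a b] sab <-]; rewrite leNgt; apply/negP => kz.
  exact: complex_shift_bij kz sab.
apply/eqP; rewrite /spectral_radius eq_le; apply/andP; split.
  by apply: ge_sup => //; exists k.
by apply: ub_le_sup => //; exists k.
Qed.

End SpectralRadiusEigen.

(** * Eigenmeasures *)

Lemma cvg_minr (R : realType) (T : Type) (F : set_system T) {FF : Filter F}
    (f g : T -> R) (a b : R) : f @ F --> a -> g @ F --> b ->
  Num.min (f x) (g x) @[x --> F] --> Num.min a b.
Proof.
move=> fa gb.
rewrite minr_absE (_ : (fun x => _) = fun x => (f x + g x - `|f x - g x|) / 2).
  apply: cvgM; last exact: cvg_cst.
  by apply: cvgB; [exact: cvgD|apply: cvg_norm; exact: cvgB].
by apply/funext => x; rewrite minr_absE.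
Qed.

Section DominatedConvergence.
Context {d : measure_display} {T : measurableType d} {R : realType}.
Variable mu : {measure set T -> \bar R}.
Implicit Types (f g : T -> R).

Lemma Rintegral_dominated (f_ : nat -> T -> R) f g :
  (forall n, measurable_fun setT (f_ n)) -> measurable_fun setT f ->
  {ae mu, forall x, f_ n x @[n --> \oo] --> f x} ->
  mu.-integrable setT (EFin \o g) -> (forall n x, `|f_ n x| <= g x) ->
  mu.-integrable setT (EFin \o f) /\
  \int[mu]_x f_ n x @[n --> \oo] --> \int[mu]_x f x.
Proof.
move=> mf_ mf f_f ig f_g.
have [] := @dominated_convergence _ _ _ mu _ measurableT (fun n => EFin \o f_ n)
  (EFin \o f) (EFin \o g).
- by move=> n; exact/measurable_EFinP.
- exact/measurable_EFinP.
- by apply: filterS f_f => x fx _; apply: cvg_EFin => //; near=> n.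
- exact: ig.
- by apply: aeW => x n _; rewrite lee_fin.
move=> jf _ H; split=> //.
by apply: fine_cvg; rewrite fineK //; exact: integrable_fin_num.
Unshelve. all: by end_near. Qed.

(** The integral of a nonnegative function is a supremum over the simple functions below it, and is
    monotone as such. *)
Lemma le_integral_nonmeasurable f g : (forall x, 0 <= f x) ->
  (forall x, f x <= g x) ->
  (\int[mu]_x (f x)%:E <= \int[mu]_x (g x)%:E)%E.
Proof.
move=> f0 fg; rewrite !ge0_integralTE; last 2 first.
- by move=> x; rewrite lee_fin (le_trans (f0 x)).
- by move=> x; rewrite lee_fin.
apply: ereal_sup_le => _ [h /= hf <-]; exists h => // x.
by apply: le_trans (hf x) _; rewrite lee_fin.
Qed.

End DominatedConvergence.

Section ContinuousMeasurable.
Context {R : realType}.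
Variable nu : probability borel_cantor R.
Implicit Types f : cantor_space -> R.

Lemma CX_measurable f : CX f -> measurable_fun setT (f : borel_cantor -> R).
Proof.
move=> /continuousP cf; apply: (measurability _ (RGenOpens.measurableE R)).
move=> _ [_ [a [b ->] <-]]; rewrite setTI; apply: sub_sigma_algebra.
exact/cf/interval_open.
Qed.

Lemma CX_integrable f : CX f -> nu.-integrable setT (EFin \o (f : borel_cantor -> R)).
Proof.
move=> cf; have [M M0 HM] := CX_bounded cf.
apply: measurable_bounded_integrable => //.
- by rewrite (le_lt_trans (probability_le1 nu measurableT)) ?ltry.
- exact: CX_measurable.
exists M; split; first exact: num_real.
by move=> z Mz x _; exact: le_trans (HM x) (ltW Mz).
Qed.

End ContinuousMeasurable.

Section Eigenmeasure.
Context {R : realType} {J : nat -> R}.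
Hypothesis J_ge0 : forall k, 0 <= J k.
Hypothesis J_sum : cvgn (series J).
Variable nu : probability borel_cantor R.

Local Notation L := (transfer (potential J)).
Local Notation r := (tail_sum J).
Local Notation fld := (fld (J := J)).
Local Notation Zsum := (Zsum (J := J)).
Local Notation mean := (mean (J := J)).
Implicit Types (f : cantor_space -> R).

Lemma CX_expR_lin n h : CX (fun x => expR (lin n h x) : R).
Proof.
by move=> x; apply: continuous_cvg; [exact: continuous_expR|exact: continuous_lin].
Qed.

Lemma iter_transfer_shift M f (g : (nat -> bool) -> R) y : prefix_fun M f ->
  iter M L (fun x => f x * g (fun k => x (M + k)%N)) y =
  g y * Zsum M (fun i => fld (M - i.+1) y) f.
Proof.
move=> df; rewrite iter_transferE //.
rewrite (eq_psum_in (G := fun x => g y * (wgt J M (fun i => fld (M - i.+1) y) x * f x))).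
  rewrite psumZ; congr (_ * _); apply: psum_base => x x' xx.
  by rewrite (prefix_wgt _ _ xx) (df _ _ xx).
move=> x xy; rewrite mulrA mulrC; congr (g _ * _); exact/funext.
Qed.

Section Weight.
Hypothesis r_cvg : {ae nu, forall x, cvgn (series (r_term J x))}.
Hypothesis r_int : (\int[nu]_x (expR (r_fun J x))%:E < +oo)%E.

(* [expR \o r_fun J] itself may fail to be measurable on the null set where the
   series diverges. *)
Lemma exp_r_version : exists w : borel_cantor -> R,
  [/\ measurable_fun setT w, forall x, 0 <= w x,
      {ae nu, forall x, 0 < w x /\ expR (lin n r x) @[n --> \oo] --> w x} &
      nu.-integrable setT (EFin \o w)].
Proof.
have [D [mD D0 HD]] := r_cvg.
pose w x := \1_(~` D) x * expR (r_fun J x).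
have oneD x : D x -> \1_(~` D) x = 0 :> R.
  by move=> Dx; rewrite indicE memNset // => /(_ Dx).
have wE x : ~ D x -> w x = expR (r_fun J x).
  by move=> Dx; rewrite /w indicE mem_set // mul1r.
have w0 x : 0 <= w x by rewrite mulr_ge0 ?expR_ge0.
have serE x n : series (r_term J x) n = lin n r x.
  by rewrite /series /= big_mkord.
have wcv x : ~ D x -> expR (lin n r x) @[n --> \oo] --> w x.
  move=> Dx; have cx : cvgn (series (r_term J x)).
    by apply: contrapT => nc; apply: Dx; exact: HD.
  rewrite wE //; apply: continuous_cvg; first exact: continuous_expR.
  rewrite -(_ : series (r_term J x) = fun n => lin n r x) //.
  by apply/funext => n; rewrite serE.
have mw : measurable_fun setT w.
  apply/measurable_EFinP.
  apply: (@emeasurable_fun_cvg _ _ _ _ (fun n x => (\1_(~` D) x * expR (lin n r x))%:E)).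
    move=> n; apply/measurable_EFinP; apply: measurable_funM.
      by apply: measurable_indic; exact: measurableC.
    exact: (CX_measurable (@CX_expR_lin n r)).
  move=> x _; apply: cvg_EFin; first exact: nearW.
  change (\1_(~` D) x * expR (lin n r x) @[n --> \oo] --> w x).
  have [Dx|Dx] := pselect (D x); last first.
    by apply: cvgM; [exact: cvg_cst|rewrite -wE //; exact: wcv].
  by rewrite /w oneD // mul0r; under eq_fun do rewrite mul0r; exact: cvg_cst.
exists w; split=> //.
  exists D; split=> // x /= nx; apply: contrapT => Dx; apply: nx.
  by split; [rewrite wE // expR_gt0|exact: wcv].
apply/integrableP; split; first exact/measurable_EFinP.
apply: le_lt_trans r_int.
under eq_integral do rewrite /= ger0_norm //.
apply: le_integral_nonmeasurable => // x.
have [Dx|Dx] := pselect (D x); last by rewrite wE.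
by rewrite /w oneD // mul0r expR_ge0.
Qed.

End Weight.

Section Eigenvalue.
Variable lam : R.
Hypothesis lam_gt0 : 0 < lam.
Hypothesis nu_eigen : forall f, CX f ->
  \int[nu]_x L f x = lam * \int[nu]_x f x.

Lemma Rintegral_iter_transfer N f : CX f ->
  \int[nu]_x iter N L f x = lam ^+ N * \int[nu]_x f x.
Proof.
move=> cf; elim: N => [|N IH]; first by rewrite expr0 mul1r.
rewrite iterS nu_eigen; last exact: continuous_iter_transfer.
by rewrite IH exprS mulrA.
Qed.

(** Positivity of an integral is thereby checked on a finite block, for every configuration to its
    right. *)
Lemma Rintegral_ge0_of_iter N f : CX f -> (forall x, 0 <= iter N L f x) ->
  0 <= \int[nu]_x f x.
Proof.
move=> cf f0; rewrite -(pmulr_rge0 _ (exprn_gt0 N lam_gt0)).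
by rewrite -Rintegral_iter_transfer //; apply: Rintegral_ge0.
Qed.

(* On the block of the first [M] sites the tilt by [r] and the fields created from
   the right add up to at least the fields of a minus boundary condition. *)
Lemma tilted_spin_ge0 i M P (d A : R) : (i < M)%N -> (M <= P)%N -> 0 <= A ->
  d <= mean M (bc r (-1) M) (fun x => spin R (x i)) ->
  0 <= \int[nu]_x ((spin R (x i) - d) *
    Num.min (expR (lin P r x)) (A * expR (lin M r x))).
Proof.
move=> iM MP A0 dM.
(* Truncating relative to [expR (lin M r x)] leaves, after factoring it out, a function of the sites
   beyond [M] alone, which passes through [iter M]. *)
pose g (y : nat -> bool) : R := Num.min (expR (lin (P - M) (fun k => r (M + k)%N) y)) A.
pose f (x : nat -> bool) : R := (spin R (x i) - d) * expR (lin M r x).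
have FE (x : nat -> bool) : (spin R (x i) - d) *
    Num.min (expR (lin P r x)) (A * expR (lin M r x)) = f x * g (fun k => x (M + k)%N).
  rewrite /f -mulrA /g (minr_pMr _ _ (expR_ge0 (lin M r x))) -expRD [A * _]mulrC.
  by congr (_ * Num.min (expR _) _); rewrite -{1}(subnKC MP) /lin big_split_ord.
have df : prefix_fun M f.
  by move=> x x' xx; rewrite /f (prefix_lin r xx) (xx _ iM).
apply: (@Rintegral_ge0_of_iter M
  (fun x => (spin R (x i) - d) * Num.min (expR (lin P r x)) (A * expR (lin M r x)))).
  move=> x; apply: cvgM.
    by apply: cvgB; [exact: continuous_spin|exact: cvg_cst].
  apply: cvg_minr; first exact: CX_expR_lin.
  by apply: cvgM; [exact: cvg_cst|exact: CX_expR_lin].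
move=> y; under [X in iter _ _ X]eq_fun do rewrite FE.
rewrite iter_transfer_shift // mulr_ge0 //.
  by rewrite le_min expR_ge0.
rewrite -Zsum_tilt ZsumE mulr_ge0 //; first exact/ltW/Z_gt0.
rewrite meanB mean_cst subr_ge0; apply: le_trans dM _.
apply: mean_mono => //; last exact: increasing_spin.
move=> k kM; rewrite /bc mulN1r addrC lerD2r.
by have /ler_normlP[] := fld_le J_ge0 J_sum (M - k.+1) y; lra.
Qed.

End Eigenvalue.
End Eigenmeasure.

(** * Consequences of positive and of vanishing magnetization *)

Section BoundFreeExp.
Context {R : realType} {J : nat -> R}.
Hypothesis J_ge0 : forall k, 0 <= J k.
Hypothesis J_sum : cvgn (series J).
Variable nu : probability borel_cantor R.

Local Notation L := (transfer (potential J)).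
Local Notation r := (tail_sum J).
Local Notation fld := (fld (J := J)).
Local Notation Zsum := (Zsum (J := J)).
Local Notation mean := (mean (J := J)).
Implicit Types (f : cantor_space -> R).

Let r_ge0 n : 0 <= r n. Proof. exact: tail_sum_ge0. Qed.

Variable lam : R.
Hypothesis lam_gt0 : 0 < lam.
Hypothesis nu_eigen : forall f, CX f ->
  \int[nu]_x L f x = lam * \int[nu]_x f x.

Variable w : borel_cantor -> R.
Hypothesis w_meas : measurable_fun setT w.
Hypothesis w_ge0 : forall x, 0 <= w x.
Hypothesis w_cvg :
  {ae nu, forall x, 0 < w x /\ expR (lin n r x) @[n --> \oo] --> w x}.
Hypothesis w_int : nu.-integrable setT (EFin \o w).

Lemma Rintegral_w_gt0 : 0 < \int[nu]_x w x.
Proof.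
rewrite lt_neqAle Rintegral_ge0 ?andbT //; apply/negP => /eqP w0.
have : (\int[nu]_x `|(w x)%:E| = 0)%E.
  under eq_integral do rewrite /= ger0_norm //.
  rewrite -[LHS]fineK ?integrable_fin_num //.
  by rewrite -/(Rintegral nu setT w) -w0.
move/(ae_eq_integral_abs nu measurableT (proj2 (measurable_EFinP _ _) w_meas)) => wz.
have : {ae nu, forall x, False}.
  apply: filterS2 wz w_cvg => x /(_ I) /= [->] [].
  by rewrite ltxx.
move=> [D [mD D0 HD]].
have DT : D = setT by apply/seteqP; split => // x _; apply: HD => /=; exact.
by have := probability_setT nu; rewrite -DT D0 => /eqP; rewrite eqe eq_sym oner_eq0.
Qed.

Lemma bounded_weight_integrable f M : measurable_fun setT (f : borel_cantor -> R) ->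
  (forall x, `|f x| <= M) -> nu.-integrable setT (EFin \o (fun x : borel_cantor => f x * w x)).
Proof.
move=> mf fM; apply: (integrableMr measurableT mf _ w_int).
exists M; split; first exact: num_real.
by move=> z Mz x _; exact: le_trans (fM x) (ltW Mz).
Qed.

Lemma measurable_spinB i d :
  measurable_fun setT (fun x : borel_cantor => spin R (x i) - d).
Proof.
apply: (@CX_measurable R (fun x => spin R (x i) - d)) => x.
by apply: cvgB; [exact: continuous_spin|exact: cvg_cst].
Qed.

Lemma spinB_le (b : bool) (d : R) : `|spin R b - d| <= 1 + `|d|.
Proof. by apply: le_trans (ler_normB _ _) _; rewrite lerD2r spin_norm. Qed.

(** Two limits remove the truncation in [tilted_spin_ge0]: first the number of sites tends to
    infinity, dominated by a multiple of [expR (lin M r x)], then the level [A], dominated by a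
    multiple of [w]. *)
Lemma weighted_spin_ge0 i M (d : R) : (i < M)%N ->
  d <= mean M (bc r (-1) M) (fun x => spin R (x i)) ->
  0 <= \int[nu]_x ((spin R (x i) - d) * w x).
Proof.
move=> iM dM.
have mE n : measurable_fun setT (fun x : borel_cantor => expR (lin n r x) : R).
  exact: (CX_measurable (@CX_expR_lin _ n r)).
have trunc (A : R) : 0 <= A -> 0 <= \int[nu]_x ((spin R (x i) - d) *
    Num.min (w x) (A * expR (lin M r x))).
  move=> A0.
  pose F n (x : borel_cantor) := (spin R (x i) - d) *
    Num.min (expR (lin (M + n) r x)) (A * expR (lin M r x)).
  have [] := @Rintegral_dominated _ _ R nu F
    (fun x => (spin R (x i) - d) * Num.min (w x) (A * expR (lin M r x)))
    (fun x => (1 + `|d|) * (A * expR (lin M r x))).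
  - move=> n; apply: measurable_funM; first exact: measurable_spinB.
    by apply: measurable_minr => //; apply: measurable_funM.
  - apply: measurable_funM; first exact: measurable_spinB.
    by apply: measurable_minr => //; apply: measurable_funM.
  - apply: filterS w_cvg => x [_ wx]; apply: cvgM; first exact: cvg_cst.
    apply: cvg_minr; last exact: cvg_cst.
    under eq_fun do rewrite addnC.
    by rewrite -(cvg_shiftn M) in wx.
  - apply: (@CX_integrable R nu (fun x => (1 + `|d|) * (A * expR (lin M r x)))) => x.
    by apply: cvgM; [exact: cvg_cst|apply: cvgM; [exact: cvg_cst|exact: CX_expR_lin]].
  - move=> n x; rewrite normrM ler_pM ?normr_ge0 ?spinB_le //.
    by rewrite ger0_norm ?ge_min ?lexx ?orbT // le_min expR_ge0 mulr_ge0 ?expR_ge0.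
  move=> _ H; rewrite -(cvg_lim (@Rhausdorff R) H); apply: limr_ge; first exact: cvgP H.
  apply: nearW => n; apply: (tilted_spin_ge0 J_ge0 J_sum lam_gt0 nu_eigen iM _ A0 dM).
  exact: leq_addr.
have [] := @Rintegral_dominated _ _ R nu (fun n (x : borel_cantor) =>
    (spin R (x i) - d) * Num.min (w x) (n%:R * expR (lin M r x)))
  (fun x => (spin R (x i) - d) * w x) (fun x => (1 + `|d|) * w x).
- move=> n; apply: measurable_funM; first exact: measurable_spinB.
  by apply: measurable_minr => //; apply: measurable_funM.
- by apply: measurable_funM; first exact: measurable_spinB.
- apply: aeW => x; apply: cvgM; first exact: cvg_cst.
  have H : (fun=> w x) @ \oo --> w x by exact: cvg_cst.
  apply: cvg_trans H; apply: near_eq_cvg.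
  near=> n; rewrite min_l // -ler_pdivrMr ?expR_gt0 //.
  by near: n; exact: nbhs_infty_ger.
- apply: (@bounded_weight_integrable (fun=> 1 + `|d|) `|1 + `|d| |) => //.
- move=> n x; rewrite normrM ler_pM ?normr_ge0 ?spinB_le //.
  by rewrite ger0_norm ?ge_min ?lexx // le_min w_ge0 mulr_ge0 ?expR_ge0.
move=> _ H; rewrite -(cvg_lim (@Rhausdorff R) H); apply: limr_ge; first exact: cvgP H.
by apply: nearW => n; exact: trunc.
Unshelve. all: by end_near. Qed.

Lemma CX_weight_integrable f : CX f ->
  nu.-integrable setT (EFin \o (fun x : borel_cantor => f x * w x)).
Proof.
move=> cf; have [M _ HM] := CX_bounded cf.
exact: (bounded_weight_integrable (CX_measurable cf) HM).
Qed.

Lemma weighted_lin_ge0 (d : R) N :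
  (forall i, 0 <= \int[nu]_x ((spin R (x i) - d) * w x)) ->
  0 <= \int[nu]_x ((lin N r x - (\sum_(i < N) r i) * d) * w x).
Proof.
move=> H; have cl n : CX (fun x => lin n r x - (\sum_(i < n) r i) * d).
  by move=> x; apply: cvgB; [exact: continuous_lin|exact: cvg_cst].
have cs n : CX (fun x => spin R (x n) - d).
  by move=> x; apply: cvgB; [exact: continuous_spin|exact: cvg_cst].
elim: N => [|N IH].
  apply: Rintegral_ge0 => x _.
  by rewrite /lin !big_ord0 mul0r subrr mul0r.
have -> : \int[nu]_x ((lin N.+1 r x - (\sum_(i < N.+1) r i) * d) * w x) =
    \int[nu]_x ((lin N r x - (\sum_(i < N) r i) * d) * w x + r N * ((spin R (x N) - d) * w x)).
  by apply: eq_Rintegral => x _; rewrite /lin !big_ord_recr /=; ring.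
rewrite RintegralD //.
- rewrite RintegralZl //; last exact: CX_weight_integrable (cs N).
  by rewrite addr_ge0 // mulr_ge0.
- exact: CX_weight_integrable (cl N).
- apply: (integrableZl measurableT (r N) (CX_weight_integrable (cs N))).
Qed.

(* The averages of the spins with weights [r i] tend to 0, since the signed sums
   converge while the total weight diverges. *)
Lemma weighted_spin_not_ge0 (d : R) : 0 < d ->
  \sum_(i < n) r i @[n --> \oo] --> +oo ->
  ~ (forall i, 0 <= \int[nu]_x ((spin R (x i) - d) * w x)).
Proof.
move=> d0 r_inf H.
pose rho n : R := \sum_(i < n) r i.
have rho_gt0 : \forall n \near \oo, 0 < rho n.
  by move/cvgryPgt : r_inf; apply.
have rhoV : (rho n)^-1 @[n --> \oo] --> (0 : R) by apply/(gtr0_cvgV0 rho_gt0).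
have cl n : CX (fun x => lin n r x / rho n - d).
  move=> x; apply: cvgB; last exact: cvg_cst.
  by apply: cvgM; [exact: continuous_lin|exact: cvg_cst].
have lin_le n x : `|lin n r x / rho n| <= 1 :> R.
  have rn : 0 <= rho n by exact: sumr_ge0.
  have : `|lin n r x| <= rho n.
    apply: le_trans (ler_norm_sum _ _ _) _; apply: ler_sum => i _.
    by rewrite normrM spin_norm mulr1 ger0_norm.
  move: rn; rewrite le_eqVlt => /orP[/eqP <-|rn].
    by rewrite invr0 mulr0 normr0 ler01.
  by rewrite normrM normfV [`|rho n|]gtr0_norm // ler_pdivrMr // mul1r.
have [] := @Rintegral_dominated _ _ R nu
    (fun n (x : borel_cantor) => (lin n r x / rho n - d) * w x)
    (fun x => (- d) * w x) (fun x => (1 + d) * w x).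
- by move=> n; apply: measurable_funM => //; exact: CX_measurable.
- exact: measurable_funM.
- apply: filterS w_cvg => x [wx wcv]; apply: cvgM; last exact: cvg_cst.
  rewrite -[X in _ --> X]sub0r; apply: cvgB; last exact: cvg_cst.
  rewrite -(mulr0 (ln (w x))); apply: cvgM rhoV.
  (* Positivity of [w x] lets the logarithm recover convergence of the sums [lin n r x]
     themselves. *)
  rewrite (_ : (fun n => _) = fun n => ln (expR (lin n r x))).
    by apply: continuous_cvg wcv; exact: continuous_ln.
  by apply/funext => n; rewrite expRK.
- apply: (@CX_weight_integrable (fun=> 1 + d)) => x; exact: cvg_cst.
- move=> n x; rewrite normrM ler_pM ?normr_ge0 //.
    by apply: le_trans (ler_normB _ _) _; rewrite lerD // gtr0_norm.
  by rewrite ger0_norm.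
move=> _; rewrite RintegralZl // => lim.
have : 0 <= - d * \int[nu]_x w x.
  rewrite -(cvg_lim (@Rhausdorff R) lim); apply: limr_ge; first exact: cvgP lim.
  apply: filterS rho_gt0 => n rn.
  rewrite -(pmulr_rge0 _ rn) -RintegralZl //; last exact: CX_weight_integrable (cl n).
  apply: le_trans (weighted_lin_ge0 n H) _.
  rewrite le_eqVlt; apply/orP; left; apply/eqP; apply: eq_Rintegral => x _.
  by rewrite -/(rho n); field; rewrite gt_eqF.
by rewrite mulNr oppr_ge0 leNgt mulr_gt0 // Rintegral_w_gt0.
Qed.

(** For any right neighbours the block mean of [f] is at least [q - e N] by [mean_near_free]. Hence
    the iterate of [f] dominates [q - e N] times that of 1; integrating and dividing by [lam ^+ N]
    leaves a bound that tends to [q]. *)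
Lemma cylinder_integral_ge l f q C : prefix_fun l f -> CX f ->
  (forall x, `|f x| <= C) ->
  (forall i, mag J r N i @[N --> \oo] --> (0 : R)) ->
  (forall N, (l <= N)%N -> q <= mean N (fun=> 0) f) ->
  q <= \int[nu]_x f x.
Proof.
move=> df cf fC mag0 qf.
have C0 : 0 <= C by apply: le_trans (fC all_plus); rewrite normr_ge0.
pose e N : R := 4 * C * \sum_(i < l) mag J r N i.
have e0 : q - e N @[N --> \oo] --> q.
  rewrite -[X in _ --> X]subr0; apply: cvgB; first exact: cvg_cst.
  rewrite -[X in _ --> X](mulr0 (4 * C)); apply: cvgM; first exact: cvg_cst.
  rewrite [X in _ --> X](_ : 0 = \sum_(i < l) (0 : R)); last by rewrite big1.
  by apply: cvg_big => [|i _]; [exact: add_continuous|exact: mag0].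
rewrite -(cvg_lim (@Rhausdorff R) e0); apply: limr_le; first exact: cvgP e0.
exists l => // N /= lN.
have c1 : CX (fun=> 1 : R) by move=> x; exact: cvg_cst.
have cLN g : CX g -> CX (iter N L g) by exact: continuous_iter_transfer.
have i1 : \int[nu]_x ((q - e N) * iter N L (fun=> 1) x) = (q - e N) * lam ^+ N.
  rewrite RintegralZl //; last exact: CX_integrable (cLN _ c1).
  rewrite (Rintegral_iter_transfer J_ge0 J_sum nu_eigen _ c1) Rintegral_cst //.
  by rewrite (_ : fine _ = 1) ?mulr1 //; exact: (congr1 fine (probability_setT nu)).
rewrite -(ler_pM2r (exprn_gt0 N lam_gt0)) -i1.
rewrite [leRHS]mulrC -(Rintegral_iter_transfer J_ge0 J_sum nu_eigen _ cf).
apply: le_Rintegral => //.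
- apply: (@CX_integrable R nu (fun x => (q - e N) * iter N L (fun=> 1) x)) => x.
  by apply: cvgM; [exact: cvg_cst|exact: cLN].
- exact: (@CX_integrable R nu _ (cLN _ cf)).
move=> y _; rewrite !iter_transfer_prefixE //; last exact: prefix_funW lN df.
rewrite mulrC [leRHS]ZsumE ler_wpM2l //; first exact/ltW/Z_gt0.
have := @mean_near_free R J r J_ge0 r_ge0 l N (fun i => fld (N - i.+1) y) f C lN df fC.
move=> /(_ _)/ler_normlP[].
  by move=> i _; exact: fld_le.
by have := qf _ lN; rewrite /e; lra.
Qed.

(** The truncated exponentials depend on finitely many spins, so their free means bound their
    integrals from below. The level 2 is the smallest that [free_exp_le_trunc] admits, and the
    truncation of the limit is at most [w]. *)
Lemma free_exp_le_Rintegral n :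
  (forall i, mag J r N i @[N --> \oo] --> (0 : R)) ->
  free_exp (J := J) r n <= \int[nu]_x w x.
Proof.
move=> mag0.
have cF P : CX (fun x : cantor_space => Num.min (expR (lin P r x)) (2 * expR (lin n r x)) : R).
  move=> x; apply: cvg_minr; first exact: CX_expR_lin.
  by apply: cvgM; [exact: cvg_cst|exact: CX_expR_lin].
have cB : CX (fun x : cantor_space => 2 * expR (lin n r x) : R).
  by move=> x; apply: cvgM; [exact: cvg_cst|exact: CX_expR_lin].
have FB P (x : cantor_space) : `|Num.min (expR (lin P r x)) (2 * expR (lin n r x))| <=
    2 * expR (lin n r x) :> R.
  by rewrite ger0_norm ?ge_min ?lexx ?orbT // le_min expR_ge0 mulr_ge0 ?expR_ge0.
have [C _ HC] := CX_bounded cB.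
have [] := @Rintegral_dominated _ _ R nu
    (fun P (x : borel_cantor) => Num.min (expR (lin (P + n) r x)) (2 * expR (lin n r x)))
    (fun x => Num.min (w x) (2 * expR (lin n r x)))
    (fun x => 2 * expR (lin n r x)).
- by move=> P; exact: (CX_measurable (@cF (P + n)%N)).
- by apply: measurable_minr => //; exact: (CX_measurable cB).
- apply: filterS w_cvg => x [_ wx]; apply: cvg_minr; last exact: cvg_cst.
  by rewrite -(cvg_shiftn n) in wx.
- exact: (CX_integrable nu cB).
- by move=> P x; exact: FB.
move=> iw H; apply: (@le_trans _ _ (\int[nu]_x Num.min (w x) (2 * expR (lin n r x)))); last first.
  by apply: le_Rintegral => // x _; rewrite ge_min lexx.
rewrite -(cvg_lim (@Rhausdorff R) H); apply: limr_ge; first exact: cvgP H.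
apply: nearW => P.
apply: (@cylinder_integral_ge (P + n) _ _ C) => //.
- move=> x x' xx; rewrite (prefix_lin r xx) (prefix_lin_le r _ xx) //.
  exact: leq_addl.
- by move=> x; apply: le_trans (FB _ x) _; apply: le_trans (HC x); rewrite ler_norm.
move=> N PN; apply: (free_exp_le_trunc J_ge0 r_ge0) => //.
exact: leq_addl.
Qed.

End BoundFreeExp.

Lemma free_exp_le_sum (R : realType) (J v : nat -> R) n K : (forall i, 0 <= v i) ->
  \sum_(i < n) v i <= K -> free_exp (J := J) v n <= expR K.
Proof.
move=> v0 vK; rewrite -(mean_cst (J := J) n (fun=> 0) (expR K)).
apply: le_mean => x; rewrite ler_expR; apply: le_trans vK.
rewrite (reindex_inj rev_ord_inj) /=; apply: ler_sum => i _.
by rewrite /spin; case: (x i); rewrite ?mulr1 // mulrN1 ge0_cp.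
Qed.

Theorem theorem1 (R : realType) (J : nat -> R)
    (J_ge0 : forall k, 0 <= J k) (J0 : J 0%N = 0) (J_sum : cvgn (series J))
    (nu : probability borel_cantor R)
    (nu_eigen : eigenmeasures (potential J) nu)
    (r_cvg : {ae nu, forall x, cvgn (series (r_term J x))})
    (r_int : (\int[nu]_x (expR (r_fun J x))%:E < +oo)%E) :
  exists h : cantor_space -> R,
    [/\ CX h,
        forall x, 0 < h x &
        forall x, transfer (potential J) h x =
                  spectral_radius (transfer (potential J)) * h x].
Proof.
pose r := tail_sum J.
have r_ge0 n : 0 <= r n by exact: tail_sum_ge0.
have r_rec n : r n = J n.+1 + r n.+1 by exact: tail_sum_rec.
have r_cvg0 : r @ \oo --> (0 : R) by exact: tail_sum_cvg0.
suff [C HC] : exists C, forall n, free_exp (J := J) r n <= C.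
  have [h [k [ch h_ge1 k_gt0 Lh]]] := free_exp_eigenfunction J_ge0 J_sum HC.
  exists h; split=> // x; first exact: lt_le_trans (h_ge1 x).
  by rewrite (spectral_radius_eigen J_ge0 J_sum ch h_ge1 k_gt0 Lh).
have [[K HK]|r_unbd] := pselect (exists K, forall n, \sum_(i < n) r i <= K).
  by exists (expR K) => n; exact: free_exp_le_sum.
have r_inf : \sum_(i < n) r i @[n --> \oo] --> +oo.
  apply/cvgryPge => A.
  have [n An] : exists n, A < \sum_(i < n) r i.
    apply: contrapT => nA; apply: r_unbd; exists A => n.
    by rewrite leNgt; apply/negP => An; apply: nA; exists n.
  exists n => // m /= nm; apply: le_trans (ltW An) _.
  rewrite -(subnKC nm) big_split_ord /= lerDl; exact: sumr_ge0.
(* A finite range would make [r] eventually constant, hence eventually 0, and its sums bounded. *)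
have J_inf n : exists2 j, (n <= j)%N & 0 < J j.+1.
  apply: contrapT => nj; apply: r_unbd.
  have J_eq0 j : (n <= j)%N -> J j.+1 = 0.
    move=> nj'; apply/eqP; rewrite eq_le J_ge0 andbT leNgt; apply/negP => Jj.
    by apply: nj; exists j.
  have r_cst j : r (n + j)%N = r n.
    elim: j => [|j IH]; first by rewrite addn0.
    by rewrite -IH addnS [in RHS]r_rec J_eq0 ?add0r // leq_addr.
  have rn0 : r n = 0.
    rewrite -(cvg_lim (@Rhausdorff R) r_cvg0); apply/esym/(cvg_lim (@Rhausdorff R)).
    have H : (fun=> r n) @ \oo --> r n by exact: cvg_cst.
    apply: cvg_trans H; apply: near_eq_cvg; exists n => // m /= nm.
    by rewrite -(subnKC nm) r_cst.
  exists (\sum_(i < n) r i) => m.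
  have [mn|nm] := leqP m n.
    by rewrite -(subnKC mn) big_split_ord /= lerDl; exact: sumr_ge0.
  rewrite -(subnKC (ltnW nm)) big_split_ord /= gerDl.
  by rewrite big1 // => i _; rewrite r_cst.
have [lam lam_gt0 eig] := nu_eigen.
have [w [w_meas w_ge0 w_cvg w_int]] := exp_r_version r_cvg r_int.
exists (\int[nu]_x w x) => n.
apply: (free_exp_le_Rintegral J_ge0 J_sum lam_gt0 eig w_meas w_cvg w_int) => i0.
apply: contrapT => mag_n0.
(* For [N > i0] the magnetization is nonnegative and nonincreasing in [N], so if it does not tend to
   0 it stays above a positive constant. *)
have [d d0 Hd] : exists2 d : R, 0 < d & forall N, (i0 < N)%N -> 2 * d <= mag J r N i0.
  apply: contrapT => nd; apply: mag_n0; apply/cvgrPdist_lt => e e0.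
  have [N iN Ne] : exists2 N, (i0 < N)%N & mag J r N i0 < e.
    apply: contrapT => nN; apply: nd; exists (e / 2); first by rewrite divr_gt0.
    move=> N iN; rewrite mulrC divfK ?pnatr_eq0 // leNgt; apply/negP => Ne.
    by apply: nN; exists N.
  exists N => // M /= NM; rewrite sub0r normrN ger0_norm ?mag_ge0 //.
  by apply: le_lt_trans Ne; exact: mag_leW.
apply: (weighted_spin_not_ge0 J_ge0 J_sum w_meas w_ge0 w_cvg w_int d0 r_inf) => i.
have [M iM dM] := bc_minus_ge J_ge0 r_ge0 r_rec r_cvg0 d0 J_inf Hd i.
exact: (weighted_spin_ge0 J_ge0 J_sum lam_gt0 eig w_meas w_ge0 w_cvg w_int iM dM).
Qed.
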